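(* Let $G=(V,c)$ be an infinite, connected graph. Then $$R^F(x,y) = \frac{1}{c_x \cdot \mathbb{P}_x[\tau_y \leq \tau_x^+]}$$ holds for all $x,y \in V$ with $x\neq y$ if and only if $G$ is recurrent.
   Context: A graph $G=(V,c)$ consists of an at most countable vertex set $V$ and a weight function $c: V\times V \to \mathbb{R}_{\ge 0}$ that is symmetric, with $c(x,x)=0$ and $c_x := \sum_{y\in V} c(x,y) < \infty$ for all $x \in V$. Vertices $x,y$ are adjacent if $c(x,y)>0$; connectedness refers to this adjacency relation. $\mathbb{P}_x$ is the law on $V^{\mathbb{N}_0}$ of the random walk $(\omega_k)_{k\ge 0}$ on $G$ started at $x$, i.e. the Markov chain with transition matrix $p(x,y)=c(x,y)/c_x$ and initial distribution $\delta_x$. $G$ is transient (recurrent) if this chain is transient (recurrent). Hitting times: $\tau_x := \inf\{k\ge 0 : \omega_k = x\}$ and $\tau_x^+ := \inf\{k\ge 1: \omega_k = x\}$, with $\inf\emptyset=\infty$; the event $\{\tau_y\le\tau_x^+\}$ includes the case $\tau_y=\tau_x^+=\infty$. Effective resistance of a finite connected graph $H=(W,c)$: for distinct $x,y \in W$, $R_H(x,y) := f(x)-f(y)$, where $f: W\to\mathbb{R}$ is any function (unique up to an additive constant) with $\sum_{w\in W} c(v,w)(f(v)-f(w)) = \mathbf{1}_{\{v=x\}} - \mathbf{1}_{\{v=y\}}$ for all $v\in W$ (the voltage drop that induces a unit current from $x$ to $y$ when each edge $(v,w)$ is a resistor of resistance $1/c(v,w)$). Free effective resistance of an infinite connected graph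 $G=(V,c)$: let $(V_n)_{n\in\mathbb{N}}$ be any sequence of finite subsets of $V$ with $V_n\subseteq V_{n+1}$, $\bigcup_n V_n = V$, such that each induced subgraph $G_n := (V_n, c\restriction_{V_n\times V_n})$ is connected. Then $R^F(x,y) := \lim_{n\to\infty} R_{G_n}(x,y)$ (taken over $n$ with $x,y\in V_n$; the limit exists and does not depend on the chosen sequence). *)

(* Defs.v *)
From HB Require Import structures.
From mathcomp Require Import all_boot all_order all_algebra.
From mathcomp Require Import finmap.
From mathcomp Require Import all_classical all_reals all_analysis.

Set Implicit Arguments.
Unset Strict Implicit.
Unset Printing Implicit Defensive.

Import Order.TTheory GRing.Theory Num.Theory.
Import numFieldNormedType.Exports.

Local Open Scope classical_set_scope.
Local Open Scope ring_scope.

(* The base point of [V] only serves to make trajectory spaces instances of   *)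
(* [measurableType]; it plays no other role.                                  *)
Record graph (R : realType) (V : pointedType) := Graph {
  weight :> V -> V -> R;
  vertices_countable : countable [set: V];
  weight_ge0 : forall x y, 0 <= weight x y;
  weight_sym : forall x y, weight x y = weight y x;
  weight_irrefl : forall x, weight x x = 0;
  weight_summable : forall x, (\esum_(y in [set: V]) (weight x y)%:E < +oo)%E
}.

(* Generators of the product sigma-algebra on V^nat, V being discrete. *)
Definition coordinate_events (V : pointedType) : set (set (nat -> V)) :=
  [set [set w | w k.1 = k.2] | k in [set: nat * V]].

Notation trajectory V := (g_sigma_algebraType (@coordinate_events V)).

Section Graph.
Variables (R : realType) (V : pointedType).
Implicit Types (G : graph R V) (W : {fset V}) (x y : V).

(* Finite, hence not truncated by [fine], thanks to [weight_summable]. *)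
Definition total_weight G x : R :=
  fine (\esum_(y in [set: V]) (G x y)%:E)%E.

Definition adjacent G : rel V := fun x y => 0 < G x y.

(* Connectedness of the subgraph induced by [A]. *)
Definition connected_on G (A : set V) : Prop :=
  forall x y, A x -> A y ->
    exists p : seq V, [/\ path (adjacent G) x p, last x p = y
                        & forall z, z \in p -> A z].

Definition connected_graph G : Prop := connected_on G [set: V].

(* [f] is a voltage function, on the subgraph induced by [W], of a unit       *)
(* current from [x] to [y]; the values of [f] outside [W] are irrelevant.     *)
Definition unit_voltage G W x y (f : V -> R) : Prop :=
  forall v, v \in W ->
    \sum_(w <- W) G v w * (f v - f w) = (v == x)%:R - (v == y)%:R.

(* Only meaningful when [x], [y] are distinct elements of [W] and the induced *)
(* subgraph is connected; the set below is then a singleton.                  *)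
Definition eff_res G W x y : R :=
  xget 0 [set f x - f y | f in unit_voltage G W x y].

Definition exhaustion G (W : nat -> {fset V}) : Prop :=
  [/\ forall n, (W n `<=` W n.+1)%fset,
      forall v, exists n, v \in W n
    & forall n, connected_on G [set` W n]].

(* The finitely many [n] with [x] or [y] outside [W n] do not affect the      *)
(* limit.                                                                     *)
Definition free_eff_res G x y : R :=
  xget 0 [set r | forall W : nat -> {fset V}, exhaustion G W ->
                    eff_res G (W n) x y @[n --> \oo] --> r].

Definition transition G x y : R := G x y / total_weight G x.

(* The second clause is the Markov property with conditional probabilities    *)
(* cleared of denominators.                                                   *)
Definition is_walk_law G x (Q : probability (trajectory V) R) : Prop :=
  (forall v, Q [set w | w 0%N = v] = ((v == x)%:R : R)%:E) /\
  (forall n (s : nat -> V),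
     Q [set w | forall i, (i <= n.+1)%N -> w i = s i] =
     (Q [set w | forall i, (i <= n)%N -> w i = s i] *
      (transition G (s n) (s n.+1))%:E)%E).

(* The infimum of the empty set is +oo. *)
Definition hitting_time x (w : trajectory V) : \bar R :=
  ereal_inf [set (k%:R : R)%:E | k in [set k : nat | w k = x]].

Definition return_time x (w : trajectory V) : \bar R :=
  ereal_inf [set (k%:R : R)%:E | k in [set k : nat | (1 <= k)%N /\ w k = x]].

Definition recurrent (P : V -> probability (trajectory V) R) : Prop :=
  forall x, P x [set w | (return_time x w < +oo)%E] = 1%E.

End Graph.

(* Main.v *)
Require Import Defs.
From HB Require Import structures.
From mathcomp Require Import all_boot all_order all_algebra.
From mathcomp Require Import finmap.
From mathcomp Require Import all_classical all_reals all_analysis.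
From mathcomp Require Import lra ring.

Import Order.TTheory GRing.Theory Num.Theory.
Import numFieldNormedType.Exports.
Local Open Scope classical_set_scope.
Local Open Scope ring_scope.

(** Fix distinct vertices x and y and write T_z for the hitting time of z. Let
    h(v) = P_v(T_x < T_y), let h'(v) = P_v(T_y < T_x), and let
    b(v) = 1 - h(v) - h'(v) be the probability that the walk from v avoids both
    x and y forever. Conditioning on the first step,
      c_x P_x(T_y <= T_x^+) = sum_w c(x,w) (1 - h(w)) =: A(x,y),
    the current that leaves x when y and infinity are both grounded. It exceeds
      sum_w c(x,w) h'(w) = c_x P_x(T_y < T_x^+)
    by sum_w c(x,w) b(w).

    On a finite connected subgraph W the effective resistance is 1 / C_W, where
    C_W is the current that leaves x under the voltage u_W with u_W(x) = 1,
    u_W(y) = 0, harmonic elsewhere ([eff_resE]). Along an exhaustion W_n the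
    voltages u_n satisfy liminf u_n >= h: the walk on W_n follows any given
    edge with at least the probability that the walk on G does, so u_n
    eventually dominates the probability of reaching x within k steps and
    before y ([liminf_hit_upto]). The same bound for 1 - u_n gives, through a
    Fatou argument at x,
      sum_w c(x,w) h'(w) <= liminf C_n <= limsup C_n <= A(x,y)
    ([le_current], [current_le]).

    If G is recurrent, b = 0 and both ends of this chain agree, so that
    C_n --> A(x,y) for every exhaustion ([free_eff_res_of_both0]).

    Conversely suppose that C_n --> A(x,y). Then the Fatou inequality at x is
    an equality, which forces u_n --> h at the neighbours of x; harmonicity
    propagates this through G, except past y, where u_n vanishes on whatever
    y separates from x ([limsup_solution]). But C_n is also the current
    sum_w c(y,w) u_n(w) that enters y, so
      A(x,y) <= sum_w c(y,w) h(w)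
    ([escape_le]). The right-hand side is at most A(y,x), and the same
    inequality with x and y exchanged closes the circle
      A(x,y) <= A(y,x) - sum_w c(y,w) b(w)
             <= A(x,y) - sum_w c(x,w) b(w) - sum_w c(y,w) b(w).
    Hence b vanishes at the neighbours of x and of y; being harmonic elsewhere
    it vanishes everywhere ([both_eq0]): almost surely the walk visits x or y.
    Then g(v) = P_v(T_x = oo) is bounded by g(y), since the walk cannot avoid
    x without visiting y; a function that is harmonic off x and maximal at y is
    constant, while g(x) = 0, so g = 0 and x is recurrent ([avoid_eq0]).

    The probabilistic input is reduced to the Markov property at time one
    ([prob_shift]), which makes h, b and g harmonic. *)
(** * The Dirichlet problem and effective resistance on a finite graph *)

Section FiniteGraph.
Set Implicit Arguments.
Unset Strict Implicit.
Context {R : realType} {V : pointedType}.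
Implicit Types (G : graph R V) (W : {fset V}).

Definition laplacian G W (f : V -> R) v := \sum_(w <- W) G v w * (f v - f w).

Lemma laplacianB G W (f g : V -> R) v :
  laplacian G W (fun w => f w - g w) v = laplacian G W f v - laplacian G W g v.
Proof. by rewrite /laplacian -sumrB; apply: eq_bigr => w _; ring. Qed.

Lemma laplacianD G W (f g : V -> R) v :
  laplacian G W (fun w => f w + g w) v = laplacian G W f v + laplacian G W g v.
Proof. by rewrite /laplacian -big_split; apply: eq_bigr => w _ /=; ring. Qed.

Lemma laplacianZ G W (f : V -> R) a v :
  laplacian G W (fun w => a * f w) v = a * laplacian G W f v.
Proof. by rewrite /laplacian mulr_sumr; apply: eq_bigr => w _; ring. Qed.

Lemma sum_laplacian G W (f : V -> R) : \sum_(v <- W) laplacian G W f v = 0.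
Proof.
have E : \sum_(v <- W) laplacian G W f v =
    \sum_(v <- W) \sum_(w <- W) G v w * (f w - f v).
  rewrite /laplacian exchange_big /=; apply: eq_bigr => v _.
  by apply: eq_bigr => w _; rewrite (weight_sym G w v).
have : \sum_(v <- W) laplacian G W f v = - \sum_(v <- W) laplacian G W f v.
  rewrite {1}E -sumrN; apply: eq_bigr => v _.
  by rewrite /laplacian -sumrN; apply: eq_bigr => w _; ring.
lra.
Qed.

(** The set where [f] attains its maximum over the region [K] is closed under
    adjacency, so connectedness drives it out of [K]. The region is arbitrary
    because it is instantiated below by the complement of two terminals, by the
    complement of one, and by the a priori unknown set where the finite voltages
    fail to converge. *)
Lemma maximum_principle G W (K : set V) (f : V -> R) (m : R) :
  connected_on G [set` W] ->
  (forall v, v \in W -> K v -> laplacian G W f v = 0) ->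
  (forall v w, v \in W -> w \in W -> K v -> ~ K w -> Defs.adjacent G v w ->
     f w <= m) ->
  (exists2 z, z \in W & ~ K z) ->
  forall v, v \in W -> K v -> f v <= m.
Proof.
move=> Wcon harm bdry [z zW Kz] v0 v0W Kv0; rewrite leNgt; apply/negP => mlt.
have [a [aW Ka amax]] : exists a, [/\ a \in W, K a &
    forall w, w \in W -> K w -> f w <= f a].
  pose P := fun v : W => `[< K (val v) >].
  have P0 : P [` v0W]%fset by apply/asboolP.
  case: (Order.TotalTheory.arg_maxP (fun v : W => f (val v)) P0) => a.
  move=> /asboolP Ka amax.
  exists (val a); split => //; first exact: valP.
  by move=> w wW Kw; apply: (amax [` wW]%fset); apply/asboolP.
have ma : m < f a by apply: lt_le_trans mlt _; exact: amax.
have step v w : v \in W -> w \in W -> K v -> f v = f a -> Defs.adjacent G v w ->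
    K w /\ f w = f a.
  move=> vW wW Kv fva vw.
  have le_fa u : u \in W -> Defs.adjacent G v u -> f u <= f a.
    move=> uW vu; case: (pselect (K u)) => [/amax -> //|Ku].
    by apply: le_trans (ltW ma); exact: bdry vu.
  have := harm v vW Kv; rewrite /laplacian big_seq => /eqP.
  rewrite psumr_eq0 => [/allP /(_ w wW)/implyP/(_ wW)|u uW]; last first.
    case: (ltP 0 (G v u)) => [vu|].
      by rewrite mulr_ge0 ?subr_ge0 ?weight_ge0// fva le_fa.
    move=> u0; have -> : G v u = 0 by apply/eqP; rewrite eq_le u0 weight_ge0.
    by rewrite mul0r.
  rewrite mulf_eq0 gt_eqF//= subr_eq0 fva => /eqP fw; split => //.
  case: (pselect (K w)) => // Kw.
  by have := bdry _ _ vW wW Kv Kw vw; rewrite leNgt -fw ma.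
have [p [pth plast pW]] := Wcon a z aW zW.
have ind q v : v \in W -> K v -> f v = f a -> path (Defs.adjacent G) v q ->
    (forall u, u \in q -> u \in W) -> K (last v q).
  elim: q v => [//|u q IH] v vW Kv fva /= /andP[vu pu] qW.
  have uW : u \in W by apply: qW; rewrite mem_head.
  have [Ku fua] := step v u vW uW Kv fva vu.
  by apply: (IH u) => // u' u'q; apply: qW; rewrite inE u'q orbT.
by apply: Kz; rewrite -plast; exact: ind.
Qed.

Lemma eq_laplacian G W (f g : V -> R) v : v \in W -> {in W, f =1 g} ->
  laplacian G W f v = laplacian G W g v.
Proof.
move=> vW fg; rewrite /laplacian [LHS]big_seq [RHS]big_seq.
by apply: eq_bigr => w wW; rewrite !fg.
Qed.

Definition extend0 W (f : {ffun W -> R^o}) (v : V) : R :=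
  if insub v is Some v' then f v' else 0.

Lemma extend0E W (f : {ffun W -> R^o}) (v : W) : extend0 f (val v) = f v.
Proof. by rewrite /extend0 valK. Qed.

Lemma extend0_in W (f : {ffun W -> R^o}) v (vW : v \in W) :
  extend0 f v = f [` vW]%fset.
Proof. by rewrite -extend0E. Qed.

(** Imposing the values at the terminals [x] and [y] inside the operator turns
    the Dirichlet problem into a square linear system. *)
Definition dirichlet_operator G W x y (f : {ffun W -> R^o}) : {ffun W -> R^o} :=
  [ffun v : W => if (val v == x) || (val v == y) then f v
                 else laplacian G W (extend0 f) (val v)].

Arguments dirichlet_operator : clear implicits.

Lemma dirichlet_operator_linear G W x y : linear (dirichlet_operator G W x y).
Proof.
move=> a f g; apply/ffunP => v; rewrite !ffunE.
case: ifP => _ //; rewrite /GRing.scale /= -laplacianZ -laplacianD.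
apply: eq_laplacian => [|w wW]; first exact: valP.
by rewrite !(extend0_in _ wW) !ffunE.
Qed.

HB.instance Definition _ G W x y := GRing.isLinear.Build R
  {ffun W -> R^o} {ffun W -> R^o} *:%R
  (dirichlet_operator G W x y) (@dirichlet_operator_linear G W x y).

Definition dirichlet G W x y (u : V -> R) : Prop :=
  [/\ u x = 1, u y = 0
    & forall v, v \in W -> v != x -> v != y -> laplacian G W u v = 0].

Lemma maximum_off_two_points G W x y (f : V -> R) m :
  connected_on G [set` W] -> x \in W -> f x <= m -> f y <= m ->
  (forall v, v \in W -> v != x -> v != y -> laplacian G W f v = 0) ->
  forall v, v \in W -> f v <= m.
Proof.
move=> Wcon xW fx fy harm v vW.
have [->//|vx] := eqVneq v x; have [->//|vy] := eqVneq v y.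
apply: (maximum_principle (K := [set v | v != x /\ v != y]) Wcon) => //.
- by move=> w wW [wx wy]; exact: harm.
- by move=> w z _ _ _ /= /not_andP[] /negP; rewrite negbK => /eqP ->.
- by exists x => //= -[]; rewrite eqxx.
Qed.

(** Uniqueness, which the maximum principle gives, is injectivity of a linear
    endomorphism of a finite-dimensional space, hence also surjectivity. *)
Lemma dirichlet_exists G W x y :
  connected_on G [set` W] -> x \in W -> y \in W -> x != y ->
  exists u, dirichlet G W x y u.
Proof.
move=> Wcon xW yW xy.
pose D := linfun (dirichlet_operator G W x y).
have DE f : D f = dirichlet_operator G W x y f by rewrite lfunE.
have Dinj : lker D == 0%VS.
  apply/lker0P => f g; rewrite !DE => fg.
  have le0 (f1 g1 : {ffun W -> R^o}) : dirichlet_operator G W x y f1 =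
      dirichlet_operator G W x y g1 -> forall v, f1 v <= g1 v.
    move=> fg1 v; rewrite -subr_le0.
    have fgv w : dirichlet_operator G W x y f1 w =
      dirichlet_operator G W x y g1 w by rewrite fg1.
    rewrite -!extend0E.
    apply: (@maximum_off_two_points G W x y
      (fun v => extend0 f1 v - extend0 g1 v) 0) => //.
    + move: (fgv [` xW]%fset); rewrite !ffunE /= eqxx /= -!extend0_in => ->.
      by rewrite subrr.
    + move: (fgv [` yW]%fset); rewrite !ffunE /= eqxx orbT -!extend0_in => ->.
      by rewrite subrr.
    + move=> w wW wx wy; rewrite laplacianB.
      move: (fgv [` wW]%fset); rewrite !ffunE /= (negPf wx) (negPf wy) /= => ->.
      by rewrite subrr.
    + exact: valP.
  by apply/ffunP => v; apply/eqP; rewrite eq_le !le0.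
pose b : {ffun W -> R^o} := [ffun v : W => (val v == x)%:R].
have : b \in limg D by rewrite (lker0_limgf Dinj) memvf.
move=> /memv_imgP[f _]; rewrite DE => bf.
have bfv w : b w = dirichlet_operator G W x y f w by rewrite bf.
exists (extend0 f); split.
- rewrite (extend0_in _ xW); move: (bfv [` xW]%fset).
  by rewrite !ffunE /= eqxx.
- rewrite (extend0_in _ yW); move: (bfv [` yW]%fset).
  rewrite !ffunE /= eqxx orbT => <-.
  by rewrite eq_sym (negPf xy).
- move=> v vW vx vy; move: (bfv [` vW]%fset).
  by rewrite !ffunE /= (negPf vx) (negPf vy) /= => <-.
Qed.

Lemma dirichlet_swap G W x y u : dirichlet G W x y u ->
  dirichlet G W y x (fun v => 1 - u v).
Proof.
move=> [ux uy harm]; split; rewrite ?ux ?uy ?subrr ?subr0// => v vW vy vx.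
rewrite laplacianB harm// subr0 /laplacian.
by apply: big1 => w _; rewrite subrr mulr0.
Qed.

Lemma dirichlet_le1 G W x y u : connected_on G [set` W] -> x \in W ->
  dirichlet G W x y u -> forall v, v \in W -> u v <= 1.
Proof.
move=> Wcon xW [ux uy harm].
by apply: (maximum_off_two_points Wcon xW _ _ harm); rewrite ?ux ?uy.
Qed.

Lemma dirichlet_ge0 G W x y u : connected_on G [set` W] -> y \in W ->
  dirichlet G W x y u -> forall v, v \in W -> 0 <= u v.
Proof.
move=> Wcon yW /dirichlet_swap dir v vW.
by have := dirichlet_le1 Wcon yW dir vW; rewrite gerBl.
Qed.

(** Conservation of current: a Laplacian sums to zero over the graph, and here
    only the terms at [x] and [y] survive. *)
Lemma dirichlet_current G W x y u : x \in W -> y \in W -> x != y ->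
  dirichlet G W x y u -> laplacian G W u y = - laplacian G W u x.
Proof.
move=> xW yW xy [ux uy harm]; apply/eqP; rewrite -addr_eq0; apply/eqP.
have := sum_laplacian G W u; rewrite (big_fsetD1 _ xW) /=.
rewrite (big_fsetD1 y) ?inE ?yW 1?eq_sym ?xy// big_seq big1.
  by rewrite /= addr0 addrC => ->.
by move=> v; rewrite !inE => /and3P[vy vx vW]; rewrite harm.
Qed.

Lemma dirichlet_current_gt0 G W x y u : connected_on G [set` W] ->
  x \in W -> y \in W -> x != y ->
  dirichlet G W x y u -> 0 < laplacian G W u x.
Proof.
move=> Wcon xW yW xy dir; have [ux uy harm] := dir.
rewrite lt_def; apply/andP; split; last first.
  rewrite /laplacian big_seq sumr_ge0// => v vW.
  by rewrite mulr_ge0 ?weight_ge0// ux subr_ge0 (dirichlet_le1 Wcon xW dir vW).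
apply/eqP => L0; have := @ltr01 R; rewrite ltNge => /negP; apply; rewrite -ux.
apply: (maximum_principle (K := [set v | v != y]) Wcon) => //.
- move=> v vW /= vy; have [->//|vx] := eqVneq v x; exact: harm.
- by move=> v w _ _ _ /= /negP; rewrite negbK => /eqP ->; rewrite uy.
- by exists y => //=; rewrite eqxx.
Qed.

(** Dividing the unit voltage drop by the current [laplacian G W u x] yields a
    unit current; two voltages of a unit current differ by a harmonic function,
    which is constant by the maximum principle off [y]. *)
Lemma eff_resE G W x y u : connected_on G [set` W] ->
  x \in W -> y \in W -> x != y ->
  dirichlet G W x y u -> eff_res G W x y = (laplacian G W u x)^-1.
Proof.
move=> Wcon xW yW xy dir; have [ux uy harm] := dir.
have L0 := dirichlet_current_gt0 Wcon xW yW xy dir.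
set L := laplacian G W u x in L0 *.
have volt : unit_voltage G W x y (fun v => L^-1 * u v).
  move=> v vW; rewrite -/(laplacian G W (fun v => L^-1 * u v) v) laplacianZ.
  have [->|vx] := eqVneq v x; first by rewrite (negPf xy) subr0 mulVf ?gt_eqF.
  have [->|vy] := eqVneq v y; last by rewrite harm// mulr0 subrr.
  by rewrite (dirichlet_current _ _ _ dir)// mulrN mulVf ?gt_eqF// sub0r.
rewrite /eff_res; apply: xget_unique.
  by exists (fun v => L^-1 * u v) => //; rewrite ux uy; ring.
move=> _ [g gvolt <-].
have H (f1 f2 : V -> R) : unit_voltage G W x y f1 -> unit_voltage G W x y f2 ->
    f1 x - f1 y <= f2 x - f2 y.
  move=> v1 v2.
  suff : f1 x - f2 x <= f1 y - f2 y by lra.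
  apply: (maximum_principle (K := [set v | v != y])
    (f := fun v => f1 v - f2 v) Wcon) => //.
  - move=> v vW _; rewrite laplacianB.
    by rewrite [X in X - _]v1// [X in _ - X]v2// subrr.
  - by move=> v w _ _ _ /= /negP; rewrite negbK => /eqP ->.
  - by exists y => //=; rewrite eqxx.
have -> : L^-1 = L^-1 * u x - L^-1 * u y by rewrite ux uy; ring.
apply/eqP; rewrite eq_le.
by rewrite (H g (fun v => L^-1 * u v))// (H (fun v => L^-1 * u v) g).
Qed.

End FiniteGraph.

(** * Countable weighted sums *)

Section WeightedSums.
Set Implicit Arguments.
Unset Strict Implicit.
Context {R : realType} {V : pointedType}.
Implicit Types (G : graph R V) (W : {fset V}) (f g : V -> R).

(** The value is meaningful when the sum is finite, which [unit_valued] ensures;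
    everything summed below is a probability. *)
Definition weighted_sum G v f : R :=
  fine (\esum_(w in [set: V]) (G v w * f w)%:E)%E.

Definition unit_valued f := forall v, 0 <= f v <= 1.

Lemma unit_valuedC f : unit_valued f -> unit_valued (fun v => 1 - f v).
Proof. by move=> f01 v; have /andP[] := f01 v; lra. Qed.

Lemma unit_valued1 : unit_valued (fun=> 1).
Proof. by move=> v; rewrite ler01 lexx. Qed.

Lemma total_weightE G v : total_weight G v = weighted_sum G v (fun=> 1).
Proof.
by rewrite /weighted_sum; congr fine; apply: eq_esum => w _; rewrite mulr1.
Qed.

Lemma esum_ge_fset (a : V -> R) W : (forall v, 0 <= a v) ->
  ((\sum_(w <- W) a w)%:E <= \esum_(w in [set: V]) (a w)%:E)%E.
Proof.
move=> a0; apply: esum_ge; exists [set` W] => //=.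
by rewrite fsbig_finite//= set_fsetK sumEFin.
Qed.

Lemma esum_le_fset (a : V -> R) M :
  (forall W, \sum_(w <- W) a w <= M) ->
  (\esum_(w in [set: V]) (a w)%:E <= M%:E)%E.
Proof.
move=> aM; apply/ereal_supP => _ [A [Afin _] <-].
by rewrite fsbig_finite//= sumEFin lee_fin.
Qed.

Lemma esum_weight_fin_num G v f : unit_valued f ->
  (\esum_(w in [set: V]) (G v w * f w)%:E)%E \is a fin_num.
Proof.
move=> f01; rewrite ge0_fin_numE; last first.
  apply: esum_ge0 => w _; rewrite lee_fin mulr_ge0 ?weight_ge0//.
  by have /andP[] := f01 w.
apply: le_lt_trans (weight_summable G v); apply: le_esum => w _.
by rewrite lee_fin ler_piMr ?weight_ge0//; have /andP[] := f01 w.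
Qed.

Lemma le_weighted_sum_fset G v f W : unit_valued f ->
  \sum_(w <- W) G v w * f w <= weighted_sum G v f.
Proof.
move=> f01; rewrite -lee_fin /weighted_sum fineK; last exact: esum_weight_fin_num.
apply: esum_ge_fset => w.
by rewrite mulr_ge0 ?weight_ge0//; have /andP[] := f01 w.
Qed.

Lemma weighted_sum_le G v f M : unit_valued f ->
  (forall W, \sum_(w <- W) G v w * f w <= M) -> weighted_sum G v f <= M.
Proof.
move=> f01 fM; rewrite -lee_fin /weighted_sum fineK; last exact: esum_weight_fin_num.
exact: esum_le_fset.
Qed.

Lemma weighted_sum_approx G v f e : unit_valued f -> 0 < e ->
  exists W, weighted_sum G v f - e <= \sum_(w <- W) G v w * f w.
Proof.
move=> f01 e0; apply: contrapT => /forallNP H.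
suff : weighted_sum G v f <= weighted_sum G v f - e by lra.
by apply: weighted_sum_le => // W; rewrite leNgt; apply/negP => /ltW /H.
Qed.

Lemma weighted_sum_ge0 G v f : unit_valued f -> 0 <= weighted_sum G v f.
Proof.
by move=> f01; have := le_weighted_sum_fset G v fset0 f01; rewrite big_seq_fset0.
Qed.

Lemma le_weighted_sum G v f g : unit_valued f -> unit_valued g ->
  (forall w, f w <= g w) -> weighted_sum G v f <= weighted_sum G v g.
Proof.
move=> f01 g01 fg; apply: weighted_sum_le => // W.
apply: le_trans (le_weighted_sum_fset G v W g01).
by apply: ler_sum => w _; rewrite ler_wpM2l ?weight_ge0.
Qed.

Lemma weighted_sumD G v f g : unit_valued f -> unit_valued g ->
  weighted_sum G v (fun w => f w + g w) =
  weighted_sum G v f + weighted_sum G v g.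
Proof.
move=> f01 g01; rewrite -fineD ?esum_weight_fin_num//; congr fine.
rewrite -esumD; last 2 first.
- by move=> w _; rewrite lee_fin mulr_ge0 ?weight_ge0//; have /andP[] := f01 w.
- by move=> w _; rewrite lee_fin mulr_ge0 ?weight_ge0//; have /andP[] := g01 w.
by apply: eq_esum => w _; rewrite mulrDr EFinD.
Qed.

Lemma eq_weighted_sum G v f g : f =1 g -> weighted_sum G v f = weighted_sum G v g.
Proof. by move=> /funext ->. Qed.

Lemma weighted_sum_fun0 G v f : (forall w, f w = 0) -> weighted_sum G v f = 0.
Proof.
by move=> f0; rewrite /weighted_sum esum1// => w _; rewrite f0 mulr0.
Qed.

Lemma weighted_sumC G v f : unit_valued f ->
  weighted_sum G v (fun w => 1 - f w) = total_weight G v - weighted_sum G v f.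
Proof.
move=> f01; rewrite total_weightE.
have -> : weighted_sum G v (fun=> 1) =
    weighted_sum G v (fun w => (1 - f w) + f w).
  by apply: eq_weighted_sum => w; rewrite subrK.
by rewrite (weighted_sumD G v (unit_valuedC f01) f01) addrK.
Qed.

Lemma weighted_sum_eq0 G v f w : unit_valued f -> weighted_sum G v f <= 0 ->
  Defs.adjacent G v w -> f w = 0.
Proof.
move=> f01 s0 vw; have := le_weighted_sum_fset G v [fset w]%fset f01.
rewrite big_seq_fset1 => /le_trans/(_ s0).
rewrite pmulr_rle0//; have /andP[f0 _] := f01 w => fw0.
by apply/eqP; rewrite eq_le fw0.
Qed.

Lemma total_weight_ge0 G v : 0 <= total_weight G v.
Proof. by rewrite total_weightE weighted_sum_ge0//; exact: unit_valued1. Qed.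

Lemma le_total_weight_fset G v W : \sum_(w <- W) G v w <= total_weight G v.
Proof.
rewrite total_weightE; apply: le_trans (le_weighted_sum_fset G v W unit_valued1).
by under [leRHS]eq_bigr do rewrite mulr1.
Qed.

(** Applied to zero sets this serves as a strong maximum principle: where a
    nonnegative function vanishes and its weighted sum does too, it vanishes at
    the neighbours ([weighted_sum_eq0]). *)
Lemma connected_ind G (Z : set V) x : connected_graph G -> Z x ->
  (forall v w, Z v -> Defs.adjacent G v w -> Z w) -> forall v, Z v.
Proof.
move=> Gcon Zx step v; have [p [pth <- _]] := Gcon x v I I.
elim: p x Zx pth => //= w p IH u Zu /andP[uw pw].
by apply: (IH w) => //; exact: step uw.
Qed.

Lemma total_weight_gt0 G v : connected_graph G -> infinite_set [set: V] ->
  0 < total_weight G v.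
Proof.
move=> Gcon Vinf; rewrite lt_def total_weight_ge0 andbT; apply/eqP => c0.
apply: Vinf; suff -> : [set: V] = [set v] by exact: finite_set1.
apply/seteqP; split=> // w _.
apply: (connected_ind (Z := [set v]) Gcon) => // _ u -> vu.
have := le_total_weight_fset G v [fset u]%fset; rewrite big_seq_fset1 c0.
by rewrite leNgt => /negP[].
Qed.

End WeightedSums.

(** * Exhaustions by finite graphs *)

Section Exhaustions.
Set Implicit Arguments.
Unset Strict Implicit.
Context {R : realType} {V : pointedType}.
Implicit Types (G : graph R V) (W : nat -> {fset V}) (f : V -> R).

Lemma ler_sum_fset (F A : {fset V}) (a : V -> R) :
  {subset F <= A} -> (forall w, w \in A -> 0 <= a w) ->
  \sum_(w <- F) a w <= \sum_(w <- A) a w.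
Proof.
move=> FA a0.
have -> : \sum_(w <- F) a w = \sum_(w <- F) if w \in F then a w else 0.
  by rewrite [LHS]big_seq [RHS]big_seq; apply: eq_bigr => w ->.
rewrite (big_fset_incl _ (B := A)) /=; last 2 first.
- exact/fsubsetP.
- by move=> w _ /negPf ->.
rewrite big_seq [leRHS]big_seq; apply: ler_sum => w wA.
by case: ifP => // _; exact: a0.
Qed.

Lemma exhaustion_near1 G W v : exhaustion G W -> \forall n \near \oo, v \in W n.
Proof.
move=> [Wmono Wcov _].
have mono n m : (n <= m)%N -> {subset W n <= W m}.
  move=> /subnK <-; elim: (m - n)%N => // k IH z /IH.
  by rewrite addSn; exact/fsubsetP/Wmono.
by have [k vk] := Wcov v; exists k => // n /= kn; exact: mono vk.
Qed.

Lemma exhaustion_near G W (F : {fset V}) : exhaustion G W ->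
  \forall n \near \oo, {subset F <= W n}.
Proof.
move=> Wexh.
have H : \forall n \near \oo, (\bigcap_(v in [set` F]) [set n | v \in W n]) n.
  by apply: filter_bigI => v _; exact: exhaustion_near1 Wexh.
by near=> n => v vF; exact: (near H n).
Unshelve. all: by end_near. Qed.

Definition liminf_ge (u : nat -> V -> R) f :=
  forall v (e : R), 0 < e -> \forall n \near \oo, f v - e <= u n v.

(** Finitely many neighbours of [v] carry all but [e / 2] of the weighted sum of
    [f], and on these [u n] eventually exceeds [f] minus a uniform error. *)
Lemma fatou_exhaustion G W u f v e : exhaustion G W ->
  (\forall n \near \oo, forall w, w \in W n -> 0 <= u n w) ->
  unit_valued f -> liminf_ge u f -> 0 < e ->
  \forall n \near \oo, weighted_sum G v f - e <= \sum_(w <- W n) G v w * u n w.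
Proof.
move=> Wexh u0 f01 uf e0.
have [F HF] := weighted_sum_approx G v f01 (divr_gt0 e0 (ltr0Sn R 1)).
(* Adding 1 keeps the denominator positive. *)
pose d := e / 2 / (total_weight G v + 1).
have c0 := total_weight_ge0 G v.
have d0 : 0 < d by rewrite !divr_gt0// ltr_wpDl.
have dc : d * total_weight G v <= e / 2.
  rewrite /d mulrAC ler_pdivrMr ?ltr_wpDl// ler_wpM2l ?lerDl//.
  by rewrite divr_ge0// ltW.
have H : \forall n \near \oo,
    (\bigcap_(w in [set` F]) [set n | f w - d <= u n w]) n.
  by apply: filter_bigI => w _; exact: uf.
near=> n.
apply: (@le_trans _ _ (\sum_(w <- F) G v w * u n w)); last first.
  apply: ler_sum_fset; first by near: n; exact: exhaustion_near Wexh.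
  move=> w wW; rewrite mulr_ge0 ?weight_ge0//.
  by move: w wW; near: n.
apply: (@le_trans _ _ (\sum_(w <- F) (G v w * f w - d * G v w))).
  rewrite sumrB -mulr_sumr.
  have := ler_wpM2l (ltW d0) (le_total_weight_fset G v F).
  lra.
rewrite big_seq [leRHS]big_seq; apply: ler_sum => w wF.
have : f w - d <= u n w by exact: (near H n).
move=> /(ler_wpM2l (weight_ge0 G v w)).
lra.
Unshelve. all: by end_near. Qed.

(** The probability that the walk from [v] reaches [x] within [k] steps and
    before [y], computed by first-step analysis. *)
Fixpoint hit_upto G x y k v : R :=
  if v == x then 1 else if v == y then 0 else
  if k is k'.+1 then weighted_sum G v (hit_upto G x y k') / total_weight G v
  else 0.

Lemma weighted_sum_le_total G v f : unit_valued f ->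
  weighted_sum G v f <= total_weight G v.
Proof.
move=> f01; rewrite total_weightE; apply: le_weighted_sum => //.
  exact: unit_valued1.
by move=> w; have /andP[] := f01 w.
Qed.

Lemma hit_upto01 G x y k : unit_valued (hit_upto G x y k).
Proof.
elim: k => [|k IH] v /=; case: eqP => _; rewrite ?lexx ?ler01//;
  case: eqP => _; rewrite ?lexx ?ler01//.
rewrite divr_ge0 ?weighted_sum_ge0 ?total_weight_ge0//=.
have [c0|c0] := eqVneq (total_weight G v) 0; first by rewrite c0 invr0 mulr0.
by rewrite ler_pdivrMr ?mul1r ?weighted_sum_le_total// lt_def c0 total_weight_ge0.
Qed.

Definition solves_on_exhaustion G W x y (u : nat -> V -> R) :=
  \forall n \near \oo, [/\ connected_on G [set` W n], x \in W n, y \in W n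
                         & dirichlet G (W n) x y (u n)].

Lemma solves_swap G W x y u : solves_on_exhaustion G W x y u ->
  solves_on_exhaustion G W y x (fun n v => 1 - u n v).
Proof.
move=> H; near=> n; have [//|Wc xW yW dir] := near H n.
by split => //; exact: dirichlet_swap.
Unshelve. all: by end_near. Qed.

Lemma solves01 G W x y u : solves_on_exhaustion G W x y u ->
  \forall n \near \oo, forall v, v \in W n -> 0 <= u n v <= 1.
Proof.
move=> H; near=> n => v vW; have [//|Wc xW yW dir] := near H n.
by rewrite (dirichlet_ge0 Wc yW dir vW) (dirichlet_le1 Wc xW dir vW).
Unshelve. all: by end_near. Qed.

(** A voltage that is harmonic at [v] thus has there the average of its values
    with respect to the total weight inside the finite graph. *)
Lemma laplacianE G (A : {fset V}) f v :
  laplacian G A f v = (\sum_(w <- A) G v w) * f v - \sum_(w <- A) G v w * f w.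
Proof.
by rewrite mulr_suml -sumrB; apply: eq_bigr => w _; rewrite mulrBr.
Qed.

(** Induction on [k]: inside a finite subgraph the total weight at [v] is at
    most that in [G], so the finite walk makes every step with at least the
    probability of the infinite one. *)
Lemma liminf_hit_upto G W x y u k : connected_graph G -> infinite_set [set: V] ->
  exhaustion G W -> solves_on_exhaustion G W x y u ->
  liminf_ge u (hit_upto G x y k).
Proof.
move=> Gcon Vinf Wexh usol.
have u0 : \forall n \near \oo, forall w, w \in W n -> 0 <= u n w.
  near=> n => w wW.
  have : forall v, v \in W n -> 0 <= u n v <= 1 by near: n; exact: solves01 usol.
  by move=> /(_ w wW)/andP[].
have base v (e : R) : 0 < e -> \forall n \near \oo,
    [/\ v == x -> 1 - e <= u n v, v == y -> 0 - e <= u n v & 0 - e <= u n v].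
  move=> e0; near=> n.
  have [//|Wc xW yW dir] := near usol n.
  have [ux uy _] := dir.
  have un0 w : w \in W n -> 0 <= u n w by move: w; near: n.
  have vW : v \in W n by near: n; exact: exhaustion_near1 Wexh.
  have := un0 v vW.
  by split=> [/eqP vx|/eqP vy|]; subst; rewrite ?ux ?uy; lra.
elim: k => [|k IH] v e e0.
  near=> n; have [//|H1 H2 H3] := near (base v e e0) n.
  by rewrite /=; case: ifP => // _; case: ifP.
have c0 := total_weight_gt0 v Gcon Vinf.
near=> n; have [//|H1 H2 H3] := near (base v e e0) n.
rewrite /=; case: ifPn => // vx; case: ifPn => // vy.
have [//|Wc xW yW [ux uy harm]] := near usol n.
have vW : v \in W n by near: n; exact: exhaustion_near1 Wexh.
have un0 : forall w, w \in W n -> 0 <= u n w by near: n.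
have unv := un0 v vW.
have := harm v vW vx vy; rewrite laplacianE => /eqP; rewrite subr_eq0 => /eqP L.
rewrite -(ler_pM2r c0) mulrBl -mulrA mulVf ?gt_eqF// mulr1.
apply: (@le_trans _ _ (\sum_(w <- W n) G v w * u n w)).
  near: n; apply: (fatou_exhaustion v Wexh u0 (hit_upto01 G x y k) IH).
  by rewrite mulr_gt0.
by rewrite -L mulrC ler_wpM2l// le_total_weight_fset.
Unshelve. all: by end_near. Qed.

End Exhaustions.

(** * Limits of the Dirichlet solutions *)

Section Limits.
Set Implicit Arguments.
Unset Strict Implicit.
Context {R : realType} {V : pointedType}.
Implicit Types (G : graph R V) (W : nat -> {fset V}) (f : V -> R).

(** The last field says that [h] is the smallest nonnegative solution, the one
    that arises as the limit of the finite-horizon probabilities. *)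
Record hit_solution G x y (h : V -> R) : Prop := HitSolution {
  hit_unit : unit_valued h;
  hit_start : h x = 1;
  hit_stop : h y = 0;
  hit_harmonic : forall v, v != x -> v != y ->
    total_weight G v * h v = weighted_sum G v h;
  hit_minimal : forall v (e : R), 0 < e ->
    exists k, h v - e <= hit_upto G x y k v
}.

Definition limsup_le (u : nat -> V -> R) f v :=
  forall e : R, 0 < e -> \forall n \near \oo, u n v <= f v + e.

Section FixedGraph.
Variables (G : graph R V) (W : nat -> {fset V}).
Hypotheses (Gcon : connected_graph G) (Vinf : infinite_set [set: V]).
Hypothesis Wexh : exhaustion G W.

Lemma liminf_hit_solution x y u h : solves_on_exhaustion G W x y u ->
  hit_solution G x y h -> liminf_ge u h.
Proof.
move=> usol hh v e e0.
have e20 : 0 < e / 2 by rewrite divr_gt0.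
have [k hk] := hit_minimal hh v e20.
have := liminf_hit_upto k Gcon Vinf Wexh usol v e20.
apply: filterS => n; lra.
Qed.

Lemma fatou_solution x y u h v e : solves_on_exhaustion G W x y u ->
  hit_solution G x y h -> 0 < e ->
  \forall n \near \oo, weighted_sum G v h - e <= \sum_(w <- W n) G v w * u n w.
Proof.
move=> usol hh e0; apply: fatou_exhaustion => //; last 2 first.
- exact: hit_unit hh.
- exact: liminf_hit_solution hh.
by apply: filterS (solves01 usol) => n H w /H /andP[].
Qed.

(** Together with [le_current]: the free conductance between [x] and [y] is at
    most the conductance from [x] to [y] and infinity both grounded, and at
    least the flow of those paths from [x] that do reach [y]. *)
Lemma current_le x y u h e : solves_on_exhaustion G W x y u ->
  hit_solution G x y h -> 0 < e ->
  \forall n \near \oo,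
    laplacian G (W n) (u n) x <= total_weight G x - weighted_sum G x h + e.
Proof.
move=> usol hh e0; near=> n.
have [//|Wc xW yW [ux uy harm]] := near usol n.
have : weighted_sum G x h - e <= \sum_(w <- W n) G x w * u n w.
  by near: n; exact: fatou_solution hh e0.
have := le_total_weight_fset G x (W n).
rewrite laplacianE ux mulr1; lra.
Unshelve. all: by end_near. Qed.

Lemma le_current x y u h e : solves_on_exhaustion G W x y u ->
  hit_solution G y x h -> 0 < e ->
  \forall n \near \oo,
    weighted_sum G x h - e <= laplacian G (W n) (u n) x.
Proof.
move=> usol hh e0; near=> n.
have [//|Wc xW yW [ux uy harm]] := near usol n.
have : weighted_sum G x h - e <= \sum_(w <- W n) G x w * (1 - u n w).
  by near: n; exact: (fatou_solution x (solves_swap usol) hh e0).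
by rewrite /laplacian ux.
Unshelve. all: by end_near. Qed.

(** Equality in Fatou: if the weighted sums at [v] do not exceed their limiting
    lower bound, no single term of positive weight can. The Fatou bound is
    applied to the sum with the neighbour [w] left out. *)
Lemma limsup_neighbour x y u h v w : solves_on_exhaustion G W x y u ->
  hit_solution G x y h ->
  (forall e : R, 0 < e -> \forall n \near \oo,
     \sum_(w <- W n) G v w * u n w <= weighted_sum G v h + e) ->
  Defs.adjacent G v w -> limsup_le u h w.
Proof.
move=> usol hh sum_le vw e e0.
pose off (f : V -> R) z := if z == w then 0 else f z.
pose d := e * G v w / 2.
have d0 : 0 < d by rewrite divr_gt0// mulr_gt0.
have h01 := hit_unit hh.
have off01 : unit_valued (off h).
  by move=> z; rewrite /off; case: ifP => _; rewrite ?lexx ?ler01.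
have hoff : weighted_sum G v h <= weighted_sum G v (off h) + G v w * h w.
  apply: weighted_sum_le => // F.
  apply: le_trans (_ : \sum_(z <- (w |` F)%fset) G v z * h z <= _).
    apply: ler_sum_fset => z; first by rewrite !inE => ->; rewrite orbT.
    by move=> _; rewrite mulr_ge0 ?weight_ge0//; have /andP[] := h01 z.
  have := le_weighted_sum_fset G v (w |` F)%fset off01.
  have wF : w \in (w |` F)%fset by rewrite !inE eqxx.
  rewrite [in X in _ -> X](big_fsetD1 _ wF) (big_fsetD1 _ wF) /= {1}/off eqxx.
  rewrite mulr0 add0r => H; rewrite addrC lerD2r; apply: le_trans H.
  rewrite big_seq [leRHS]big_seq; apply: ler_sum => z.
  by rewrite !inE /off => /andP[/negPf -> _].
have uoff : liminf_ge (fun n => off (u n)) (off h).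
  move=> z d' d'0; rewrite /off; case: ifP => _.
    by near=> n; rewrite sub0r oppr_le0 ltW.
  exact: liminf_hit_solution hh z d' d'0.
have uoff0 : \forall n \near \oo, forall z, z \in W n -> 0 <= off (u n) z.
  apply: filterS (solves01 usol) => n H z /H /andP[H0 _].
  by rewrite /off; case: ifP.
near=> n.
have wW : w \in W n by near: n; exact: exhaustion_near1 Wexh.
have H2 : \sum_(z <- W n) G v z * u n z <= weighted_sum G v h + d.
  by near: n; exact: sum_le.
have H1 : weighted_sum G v (off h) - d <= \sum_(z <- W n) G v z * off (u n) z.
  by near: n; exact: fatou_exhaustion uoff d0.
have E : \sum_(z <- (W n `\ w)%fset) G v z * off (u n) z =
         \sum_(z <- (W n `\ w)%fset) G v z * u n z.
  rewrite [LHS]big_seq [RHS]big_seq; apply: eq_bigr => z.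
  by rewrite !inE /off => /andP[/negPf -> _].
rewrite (big_fsetD1 _ wW) /= E /off eqxx mulr0 add0r in H1.
rewrite (big_fsetD1 _ wW) /= in H2.
rewrite -(ler_pM2l vw) mulrDr.
have : d + d = G v w * e by rewrite /d; field.
lra.
Unshelve. all: by end_near. Qed.

(** If the currents out of [x] are asymptotically as large as [current_le]
    allows, the finite voltages converge to [h]. The set of vertices where they
    do contains [x] and is closed under adjacency except at [y]. On the rest,
    which only [y] can border, the maximum principle bounds the voltages by
    their value zero at [y]. *)
Lemma limsup_solution x y u h : solves_on_exhaustion G W x y u ->
  hit_solution G x y h ->
  (forall e : R, 0 < e -> \forall n \near \oo,
    total_weight G x - weighted_sum G x h - e <= laplacian G (W n) (u n) x) ->
  forall v, limsup_le u h v.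
Proof.
move=> usol hh lim_ge.
have h0 v : 0 <= h v by have /andP[] := hit_unit hh v.
have goodx : limsup_le u h x.
  move=> e e0; near=> n; have [//|Wc xW yW [-> _ _]] := near usol n.
  by rewrite (hit_start hh) lerDl ltW.
have goody : limsup_le u h y.
  move=> e e0; near=> n; have [//|Wc xW yW [_ -> _]] := near usol n.
  by rewrite (hit_stop hh) add0r ltW.
have step v w : limsup_le u h v -> v != y -> Defs.adjacent G v w ->
    limsup_le u h w.
  move=> goodv vy vw; apply: (limsup_neighbour usol hh _ vw) => e e0.
  have [->|vx] := eqVneq v x.
    near=> n; have [//|Wc xW yW [ux uy harm]] := near usol n.
    have : total_weight G x - weighted_sum G x h - e <=
           laplacian G (W n) (u n) x.
      by near: n; exact: lim_ge.
    rewrite laplacianE ux mulr1.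
    have := le_total_weight_fset G x (W n); lra.
  have c0 := total_weight_gt0 v Gcon Vinf.
  have d0 : 0 < e / total_weight G v by rewrite divr_gt0.
  near=> n; have [//|Wc xW yW [ux uy harm]] := near usol n.
  have vW : v \in W n by near: n; exact: exhaustion_near1 Wexh.
  have : forall v, v \in W n -> 0 <= u n v <= 1.
    by near: n; exact: solves01 usol.
  move=> /(_ v vW)/andP[u0 _].
  have : u n v <= h v + e / total_weight G v by near: n; exact: goodv.
  move=> /(ler_wpM2l (ltW c0)).
  rewrite mulrDr (hit_harmonic hh)// (mulrC _ (e / _)) divfK ?gt_eqF//.
  have := harm v vW vx vy; rewrite laplacianE => /eqP.
  rewrite subr_eq0 => /eqP <-.
  have := ler_wpM2r u0 (le_total_weight_fset G v (W n)).
  lra.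
move=> v; apply: contrapT => badv; apply: (badv) => e e0.
near=> n; have [//|Wc xW yW [ux uy harm]] := near usol n.
have vW : v \in W n by near: n; exact: exhaustion_near1 Wexh.
apply: (@le_trans _ _ 0); last by rewrite addr_ge0// ltW.
apply: (maximum_principle (K := [set w | ~ limsup_le u h w]) Wc) => //.
- move=> w wW badw.
  by apply: harm => //; apply/eqP => ww; apply: badw; rewrite ww.
- move=> z w zW wW /= badz /contrapT goodw zw.
  have [->|wy] := eqVneq w y; first by rewrite uy.
  exfalso; apply: badz; apply: (step w z goodw wy).
  by rewrite /Defs.adjacent weight_sym.
- by exists x => //=; apply.
Unshelve. all: by end_near. Qed.

(** The current entering [y] is a weighted sum of voltages at [y]. These are
    at most 1 and converge to [h], so it cannot exceed in the limit the weighted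
    sum of [h]. *)
Lemma escape_le x y u h : x != y -> solves_on_exhaustion G W x y u ->
  hit_solution G x y h ->
  (forall e : R, 0 < e -> \forall n \near \oo,
    total_weight G x - weighted_sum G x h - e <= laplacian G (W n) (u n) x) ->
  total_weight G x - weighted_sum G x h <= weighted_sum G y h.
Proof.
move=> xy usol hh lim_ge; apply/ler_addgt0Pr => e e0.
have e20 : 0 < e / 2 by rewrite divr_gt0.
have h01 := hit_unit hh.
have lims := limsup_solution usol hh lim_ge.
have liminf : liminf_ge (fun n v => 1 - u n v) (fun v => 1 - h v).
  by move=> v d d0; apply: filterS (lims v d d0) => n; lra.
have u0 : \forall n \near \oo, forall w, w \in W n -> 0 <= 1 - u n w.
  by apply: filterS (solves01 usol) => n H w /H /andP[_]; rewrite subr_ge0.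
suff /filter_ex[_ //] : \forall n \near \oo,
  total_weight G x - weighted_sum G x h <= weighted_sum G y h + e.
near=> n.
have [//|Wc xW yW dir] := near usol n.
have [ux uy harm] := dir.
have : total_weight G x - weighted_sum G x h - e / 2 <=
       laplacian G (W n) (u n) x.
  by near: n; exact: lim_ge.
have := dirichlet_current xW yW xy dir; rewrite laplacianE uy mulr0 sub0r.
move=> /oppr_inj <-.
have : weighted_sum G y (fun v => 1 - h v) - e / 2 <=
       \sum_(w <- W n) G y w * (1 - u n w).
  near: n; exact: fatou_exhaustion Wexh u0 (unit_valuedC h01) liminf e20.
rewrite weighted_sumC//.
have -> : \sum_(w <- W n) G y w * (1 - u n w) =
  \sum_(w <- W n) G y w - \sum_(w <- W n) G y w * u n w.
  by rewrite -sumrB; apply: eq_bigr => w _; ring.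
have := le_total_weight_fset G y (W n).
lra.
Unshelve. all: by end_near. Qed.

End FixedGraph.
End Limits.

(** * The Markov property of the walk *)

Section TrajectoryEvents.
Set Implicit Arguments.
Unset Strict Implicit.
Context {V : pointedType}.
Hypothesis Vcount : countable [set: V].
Local Notation T := (trajectory V).

Lemma measurable_exists (I : Type) (Q : I -> T -> Prop) : countable [set: I] ->
  (forall i, measurable [set w : T | Q i w]) ->
  measurable [set w : T | exists i, Q i w].
Proof.
move=> Ic mQ.
have -> : [set w : T | exists i, Q i w] = \bigcup_i [set w : T | Q i w].
  by apply/seteqP; split=> w /= [i Qi]; [exists i|move=> q; exists i].
exact: countable_bigcupT_measurable.
Qed.

Lemma measurable_not (Q : T -> Prop) : measurable [set w : T | Q w] ->
  measurable [set w : T | ~ Q w].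
Proof. by move=> /measurableC. Qed.

Lemma measurable_forall (I : Type) (Q : I -> T -> Prop) : countable [set: I] ->
  (forall i, measurable [set w : T | Q i w]) ->
  measurable [set w : T | forall i, Q i w].
Proof.
move=> Ic mQ.
have -> : [set w : T | forall i, Q i w] = ~` [set w : T | exists i, ~ Q i w].
  apply/seteqP; split=> w /= H; first by case=> i; apply.
  by move=> i; apply: contrapT => q; apply: H; exists i.
by apply: measurableC; apply: measurable_exists => // i; exact: measurable_not.
Qed.

Lemma measurable_conj (Q Q' : T -> Prop) :
  measurable [set w : T | Q w] -> measurable [set w : T | Q' w] ->
  measurable [set w : T | Q w /\ Q' w].
Proof. by move=> mQ mQ'; exact: measurableI. Qed.

Lemma measurable_constant (p : Prop) : measurable [set w : T | p].
Proof.
case: (pselect p) => pp.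
  by rewrite (_ : [set _ | _] = setT) //; apply/seteqP; split.
by rewrite (_ : [set _ | _] = set0) //; apply/seteqP; split.
Qed.

Lemma measurable_imply (p : Prop) (Q : T -> Prop) :
  measurable [set w : T | Q w] -> measurable [set w : T | p -> Q w].
Proof.
move=> mQ; have -> : [set w : T | p -> Q w] = ~` [set w : T | p /\ ~ Q w].
  by apply/seteqP; split=> w /=; [move=> pQ [/pQ]|move=> /not_andP[//|/contrapT]].
apply: measurableC; apply: measurable_conj; first exact: measurable_constant.
exact: measurable_not.
Qed.

Lemma measurable_at k v : measurable [set w : T | w k = v].
Proof. by apply: sub_sigma_algebra; exists (k, v). Qed.

Definition shift (w : T) : T := fun n => w n.+1.

Lemma measurable_shift : measurable_fun [set: T] shift.
Proof.
apply: (@measurability _ _ T T setT shift (@coordinate_events V)) => //.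
move=> _ [_ [[k v] _ <-] <-]; rewrite setTI.
exact: measurable_at k.+1 v.
Qed.

Lemma measurable_shift_preimage (B : set T) : measurable B ->
  measurable (shift @^-1` B).
Proof. by move=> mB; rewrite -[X in measurable X]setTI; exact: measurable_shift. Qed.

Definition cylinder n (s : nat -> V) : set T :=
  [set w : T | forall i, (i <= n)%N -> w i = s i].

Lemma measurable_cylinder n s : measurable (cylinder n s).
Proof.
apply: (@measurable_forall nat (fun i w => (i <= n)%N -> w i = s i)).
  exact: countableP.
by move=> i; apply: measurable_imply; exact: measurable_at.
Qed.

(** Adding the empty set makes the cylinders a pi-system, and adding the whole
    space gives it a trivial countable cover. *)
Definition cylinders : set (set T) :=
  [set A | [\/ A = setT, A = set0 | exists n s, A = cylinder n s]].

Lemma cylinders_setI_closed : setI_closed cylinders.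
Proof.
have CI n m s t : (n <= m)%N -> cylinders (cylinder n s `&` cylinder m t).
  move=> nm; case: (pselect (forall i, (i <= n)%N -> s i = t i)) => st.
    apply: Or33; exists m, t; apply/seteqP; split=> w /=; first by case.
    by move=> wt; split=> // i ni; rewrite st// wt// (leq_trans ni).
  apply: Or32; apply/seteqP; split=> w //= [ws wt]; apply: st => i ni.
  by rewrite -ws// wt// (leq_trans ni).
move=> A B [->|->|[n [s ->]]].
- by rewrite setTI.
- by rewrite set0I => _; apply: Or32.
move=> [->|->|[m [t ->]]].
- by rewrite setIT; apply: Or33; exists n, s.
- by rewrite setI0; apply: Or32.
by have [nm|/ltnW nm] := leqP n m; [|rewrite setIC]; exact: CI.
Qed.

(** A coordinate event is a countable union of cylinders, as there are only
    countably many ways to fill in the earlier coordinates. *)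
Lemma trajectory_measurableE : @measurable _ T = <<s cylinders >>.
Proof.
apply/seteqP; split; last first.
  apply: smallest_sub; first exact: sigma_algebra_measurable.
  move=> A [->|->|[n [s ->]]] //; exact: measurable_cylinder.
apply: smallest_sub; first exact: smallest_sigma_algebra.
move=> _ [[k v] _ <-] /=.
pose T' := g_sigma_algebraType cylinders.
(* The coordinates between n and n + m are fixed one at a time. *)
have H m n (s : nat -> V) :
    @measurable _ T' [set w : T' | cylinder n s w /\ w (n + m)%N = v].
  elim: m n s => [|m IH] n s.
    case: (pselect (s n = v)) => sv.
      rewrite (_ : [set _ | _] = cylinder n s).
        by apply: sub_sigma_algebra; apply: Or33; exists n, s.
      by apply/seteqP; split=> w /=; [case|move=> ws; rewrite addn0 ws].
    rewrite (_ : [set _ | _] = set0) //.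
    by apply/seteqP; split=> w //= -[ws]; rewrite addn0 ws.
  pose s' u i := if (i <= n)%N then s i else u.
  rewrite (_ : [set _ | _] =
    \bigcup_u [set w : T' | cylinder n.+1 (s' u) w /\ w (n.+1 + m)%N = v]).
    by apply: countable_bigcupT_measurable => // u; exact: IH.
  apply/seteqP; split=> w /=.
    move=> [ws wv]; exists (w n.+1) => //; split; last by rewrite addSnnS.
    move=> i; rewrite leq_eqVlt => /predU1P[->|]; rewrite /s' ?ltnn// ltnS => ni.
    by rewrite ni ws.
  move=> [u _ [ws wv]]; split; last by rewrite -addSnnS.
  by move=> i ni; rewrite ws ?(leqW ni)// /s' ni.
rewrite (_ : [set _ | _] =
    \bigcup_u [set w : T' | cylinder 0 (fun=> u) w /\ w (0 + k)%N = v]).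
  by apply: (@countable_bigcupT_measurable _ T') => // u; exact: H.
apply/seteqP; split=> w /= => [wv|[u _ [_ //]]].
by exists (w 0%N) => //; split=> // i; rewrite leqn0 => /eqP ->.
Qed.

End TrajectoryEvents.

Section WalkLaw.
Set Implicit Arguments.
Unset Strict Implicit.
Context {R : realType} {V : pointedType} (G : graph R V).
Variable P : V -> probability (trajectory V) R.
Hypothesis hP : forall x, is_walk_law G x (P x).
Local Notation T := (trajectory V).
Let Vcount : countable [set: V] := vertices_countable G.

Lemma cylinder_prob x n s : P x (cylinder n s) =
  ((s 0%N == x)%:R * \prod_(i < n) transition G (s i) (s i.+1))%:E.
Proof.
elim: n => [|n IH].
  rewrite big_ord0 mulr1 -(hP x).1; congr (P x _); apply/seteqP.
  by split=> w /= H => [|i]; [exact: H | rewrite leqn0 => /eqP ->].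
by rewrite (hP x).2 IH big_ord_recr/= mulrA EFinM.
Qed.

Lemma transition_ge0 x y : 0 <= transition G x y.
Proof. by rewrite divr_ge0 ?weight_ge0 ?total_weight_ge0. Qed.

Lemma start_prob x : P x [set w : T | w 0%N = x] = 1%E.
Proof. by rewrite (hP x).1 eqxx. Qed.

(** The walk starts at [x] almost surely. *)
Lemma prob_start x (A : set T) : measurable A ->
  P x A = P x (A `&` [set w : T | w 0%N = x]).
Proof.
move=> mA.
have m0 := measurable_at 0 x.
have mI : measurable (A `&` [set w : T | w 0%N = x]) by exact: measurableI.
have mD : measurable (A `\` [set w : T | w 0%N = x]) by exact: measurableD.
rewrite {1}(_ : A = (A `&` [set w : T | w 0%N = x]) `|`
                    (A `\` [set w : T | w 0%N = x])); last by rewrite setUIDK.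
rewrite measureU//; last by rewrite setDE setIACA setICr setI0.
rewrite [X in (_ + X)%E](_ : _ = 0%E) ?adde0//.
apply/eqP; rewrite eq_le measure_ge0 andbT.
apply: (@le_trans _ _ (P x (~` [set w : T | w 0%N = x]))).
  apply: le_measure; rewrite ?inE//; exact: measurableC.
by rewrite probability_setC// start_prob subee.
Qed.

Lemma one_step_cylinder x v n s :
  P x ([set w : T | w 1%N = v] `&` shift @^-1` (cylinder n s)) =
  ((transition G x v)%:E * P v (cylinder n s))%E.
Proof.
have mE : measurable ([set w : T | w 1%N = v] `&` shift @^-1` (cylinder n s)).
  apply: measurableI; first exact: measurable_at.
  by apply: measurable_shift_preimage; exact: measurable_cylinder.
rewrite [RHS](_ : _ = (transition G x v * ((s 0%N == v)%:R *
    \prod_(i < n) transition G (s i) (s i.+1)))%:E); last first.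
  by rewrite cylinder_prob EFinM.
have [sv|sv] := eqVneq (s 0%N) v; last first.
  rewrite mul0r mulr0 (_ : _ `&` _ = set0) ?measure0//.
  apply/seteqP; split=> w //= -[wv ws].
  by move: sv; rewrite -(ws 0%N)//= /shift wv eqxx.
rewrite mul1r prob_start//.
pose s' i := if i is j.+1 then s j else x.
rewrite (_ : _ `&` _ = cylinder n.+1 s').
  by rewrite cylinder_prob /= eqxx mul1r big_ord_recl /= sv.
apply/seteqP; split=> w /=.
  by move=> [[wv ws] w0] [|i] //= /ws.
move=> ws; split; last exact: ws 0%N _.
split; first by rewrite (ws 1%N).
by move=> i ni; rewrite /shift ws.
Qed.

(** The Markov property at time one. Both sides are finite measures in [B] and
    agree on the pi-system of cylinders. *)
Lemma one_step x v (B : set T) : measurable B ->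
  P x ([set w : T | w 1%N = v] `&` shift @^-1` B) =
  ((transition G x v)%:E * P v B)%E.
Proof.
have mv := measurable_at 1 v.
have mshift := @measurable_shift V.
pose m1 : {measure set T -> \bar R} :=
  ltac:(unshelve refine (pushforward (mrestr (P x) mv) shift); exact: mshift).
pose m2 : {measure set T -> \bar R} :=
  mscale (NngNum (transition_ge0 x v)) (P v).
have m1E C : m1 C = P x ([set w : T | w 1%N = v] `&` shift @^-1` C).
  by rewrite setIC.
have m12 C : cylinders C -> m1 C = m2 C.
  have mT : m1 setT = m2 setT.
    rewrite m1E preimage_setT setIT prob_start; last exact: measurable_at.
    rewrite /m2/= /mscale/= probability_setT mule1.
    pose s i := if i is _.+1 then v else x.
    rewrite (_ : _ `&` _ = cylinder 1 s).
      by rewrite cylinder_prob /= eqxx mul1r big_ord_recl big_ord0 mulr1.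
    apply/seteqP; split=> w /= => [[w1 w0] [|[|i]] //|ws].
    by rewrite !ws.
  move=> [->|->|[n [s ->]]].
  - exact: mT.
  - by rewrite !measure0.
  - by rewrite m1E one_step_cylinder.
move=> mB; rewrite -m1E -[RHS]/(m2 B).
apply: (measure_unique cylinders (fun=> setT) _ _ _ _ m1 m2) => //.
- exact: (trajectory_measurableE Vcount).
- exact: cylinders_setI_closed.
- by move=> _; apply: Or31.
- by rewrite bigcup_const//; exists 0%N.
move=> _; rewrite m1E; apply: le_lt_trans (ltry 1).
apply: probability_le1; apply: measurableI => //.
exact: measurable_shift_preimage.
Qed.

End WalkLaw.

(** * Hitting probabilities *)

Section HittingProbabilities.
Set Implicit Arguments.
Unset Strict Implicit.
Context {R : realType} {V : pointedType} (G : graph R V).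
Variable P : V -> probability (trajectory V) R.
Hypothesis hP : forall x, is_walk_law G x (P x).
Hypotheses (Gcon : connected_graph G) (Vinf : infinite_set [set: V]).
Local Notation T := (trajectory V).
Let Vcount : countable [set: V] := vertices_countable G.

Definition prob x (A : set T) : R := fine (P x A).

Lemma probE x A : measurable A -> (prob x A)%:E = P x A.
Proof. by move=> mA; rewrite /prob fineK// fin_num_measure. Qed.

Lemma prob01 (A : set T) : measurable A -> unit_valued (prob^~ A).
Proof.
by move=> mA v; rewrite -!lee_fin probE// measure_ge0 probability_le1.
Qed.

Lemma prob_mono x (A B : set T) : measurable A -> measurable B ->
  A `<=` B -> prob x A <= prob x B.
Proof.
by move=> mA mB AB; rewrite -lee_fin !probE//; apply: le_measure; rewrite ?inE.
Qed.

Lemma eq_prob_start x (A B : set T) : measurable A -> measurable B ->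
  (forall w : T, w 0%N = x -> (A w <-> B w)) -> prob x A = prob x B.
Proof.
move=> mA mB AB; congr fine; rewrite (prob_start hP _ mA) (prob_start hP _ mB).
by congr (P x _); apply/seteqP; split=> w /= [H w0]; split=> //; apply/(AB w w0).
Qed.

Lemma prob_sure x (A : set T) : measurable A ->
  (forall w : T, w 0%N = x -> A w) -> prob x A = 1.
Proof.
move=> mA HA; rewrite (@eq_prob_start x A setT) //.
  by rewrite /prob probability_setT.
by move=> w /HA.
Qed.

Lemma prob_never x (A : set T) : measurable A ->
  (forall w : T, w 0%N = x -> ~ A w) -> prob x A = 0.
Proof.
move=> mA HA; rewrite (@eq_prob_start x A set0) //.
  by rewrite /prob measure0.
by move=> w /HA.
Qed.

Lemma prob_setC x (A : set T) : measurable A -> prob x (~` A) = 1 - prob x A.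
Proof.
move=> mA; apply: EFin_inj; rewrite EFinB !probE//; last exact: measurableC.
by rewrite probability_setC.
Qed.

Lemma prob_setU x (A B : set T) : measurable A -> measurable B ->
  A `&` B = set0 -> prob x (A `|` B) = prob x A + prob x B.
Proof.
move=> mA mB AB; apply: EFin_inj; rewrite EFinD !probE//; last exact: measurableU.
by rewrite measureU.
Qed.

(** First-step analysis: the event is partitioned according to the position at
    time one. Multiplying by the total weight clears the denominators of the
    transition probabilities. *)
Lemma prob_shift x (B : set T) : measurable B ->
  total_weight G x * prob x (shift @^-1` B) = weighted_sum G x (prob^~ B).
Proof.
move=> mB.
have /card_esym/card_set_bijP[e ebij] := eq_card_nat Vcount Vinf.
have c0 := total_weight_gt0 x Gcon Vinf.
pose m : {measure set T -> \bar R} := mscale (NngNum (ltW c0)) (P x).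
pose F n := [set w : T | w 1%N = e n] `&` shift @^-1` B.
have mF n : measurable (F n).
  apply: measurableI; first exact: measurable_at.
  exact: measurable_shift_preimage.
have UF : shift @^-1` B = \bigcup_n F n.
  apply/seteqP; split=> w /= => [Bw|[n _ [_]]//].
  have [_ _ /(_ (w 1%N) I)[n _ en]] := ebij.
  by exists n.
have : m (\bigcup_n F n) = (\sum_(0 <= n <oo) m (F n))%E.
  apply: measure_semi_bigcup => //; last first.
    by rewrite -UF; exact: measurable_shift_preimage.
  apply/trivIsetP => i j _ _ ij; apply/seteqP; split=> w //= -[[wi _] [wj _]].
  move/eqP: ij; apply; have [_ einj _] := ebij.
  by apply: einj; rewrite ?inE// -wi -wj.
rewrite nneseries_esumT; last by move=> n; exact: measure_ge0.
rewrite -UF.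
rewrite /m /= /mscale /= -(probE _ (measurable_shift_preimage mB)) -EFinM => E.
apply: EFin_inj; rewrite E /weighted_sum (reindex_esum _ _ _ _ ebij) [RHS]fineK.
  apply: eq_esum => n _; rewrite (one_step hP)// -probE// -!EFinM; congr (_%:E).
  by rewrite /transition mulrA (mulrC (total_weight G x)) divfK ?gt_eqF.
rewrite -(reindex_esum _ _ _ (fun w => (G x w * prob w B)%:E) ebij).
by apply: esum_weight_fin_num; exact: prob01.
Qed.

Lemma prob_shift_div v (B : set T) : measurable B ->
  prob v (shift @^-1` B) = weighted_sum G v (prob^~ B) / total_weight G v.
Proof.
move=> mB; rewrite -prob_shift// mulrC mulKf//.
by rewrite gt_eqF// total_weight_gt0.
Qed.

Lemma prob_continuous v (F : nat -> set T) (A : set T) (e : R) :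
  (forall n, measurable (F n)) -> measurable A ->
  P v (F n) @[n --> \oo] --> P v A -> 0 < e ->
  exists k, `|prob v A - prob v (F k)| <= e.
Proof.
move=> mF mA; rewrite -probE// => /fine_cvgP[_] /cvgrPdist_le H e0.
by have /filter_ex[k] := H e e0; exists k.
Qed.

Definition hit_at x y n : set T :=
  [set w : T | w n = x /\ forall i, (i <= n)%N -> w i <> y].

Definition hit_before x y : set T := [set w : T | exists n, hit_at x y n w].

Definition hit_before_upto x y k : set T :=
  [set w : T | exists n, (n <= k)%N /\ hit_at x y n w].

Definition avoid x : set T := [set w : T | forall n, w n <> x].

Definition avoid_upto x y k : set T :=
  [set w : T | forall n, (n <= k)%N -> w n <> x /\ w n <> y].

Lemma measurable_not_at k v : measurable [set w : T | w k <> v].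
Proof. by apply: measurable_not; exact: measurable_at. Qed.

Lemma measurable_hit_at x y n : measurable (hit_at x y n).
Proof.
apply: (@measurable_conj V (fun w => w n = x)); first exact: measurable_at.
apply: (@measurable_forall V nat (fun i w => (i <= n)%N -> w i <> y)) => // i.
by apply: measurable_imply; exact: measurable_not_at.
Qed.

Lemma measurable_hit_before x y : measurable (hit_before x y).
Proof.
apply: (@measurable_exists V nat (hit_at x y)) => // n.
exact: measurable_hit_at.
Qed.

Lemma measurable_hit_before_upto x y k : measurable (hit_before_upto x y k).
Proof.
apply: (@measurable_exists V nat
  (fun n w => (n <= k)%N /\ hit_at x y n w)) => // n.
apply: (@measurable_conj V (fun w => (n <= k)%N)); first exact: measurable_constant.
exact: measurable_hit_at.
Qed.

Lemma measurable_avoid x : measurable (avoid x).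
Proof.
apply: (@measurable_forall V nat (fun n w => w n <> x)) => // n.
exact: measurable_not_at.
Qed.

Lemma measurable_avoid_upto x y k : measurable (avoid_upto x y k).
Proof.
apply: (@measurable_forall V nat
  (fun n w => (n <= k)%N -> w n <> x /\ w n <> y)) => // n.
apply: measurable_imply.
by apply: (@measurable_conj V (fun w => w n <> x)); exact: measurable_not_at.
Qed.

Lemma hit_at_start x y (w : T) : x <> y -> w 0%N = x -> hit_at x y 0 w.
Proof. by move=> xy w0; split=> // i; rewrite leqn0 => /eqP ->; rewrite w0. Qed.

Lemma hit_before_stop x y (w : T) : w 0%N = y -> ~ hit_before x y w.
Proof. by move=> w0 [n [_ /(_ 0%N isT)]]. Qed.

Lemma hit_before_shift x y v (w : T) : v <> x -> v <> y -> w 0%N = v ->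
  hit_before x y w <-> hit_before x y (shift w).
Proof.
move=> vx vy w0; split.
  move=> [[|n] [wn H]]; first by rewrite w0 in wn.
  by exists n; split=> // i ni; exact: (H i.+1).
move=> [n [wn H]]; exists n.+1; split=> // -[_|i ni]; first by rewrite w0.
exact: H.
Qed.

Lemma hit_before_upto_shift x y k v (w : T) : v <> x -> v <> y -> w 0%N = v ->
  hit_before_upto x y k.+1 w <-> hit_before_upto x y k (shift w).
Proof.
move=> vx vy w0; split.
  move=> [[|n] [nk [wn H]]]; first by rewrite w0 in wn.
  by exists n; split=> //; split=> // i ni; exact: (H i.+1).
move=> [n [nk [wn H]]]; exists n.+1; split=> //; split=> // -[_|i ni].
  by rewrite w0.
exact: H.
Qed.

Lemma prob_hit_before_upto x y k : x <> y ->
  prob^~ (hit_before_upto x y k) = hit_upto G x y k.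
Proof.
move=> xy; elim: k => [|k IH]; apply/funext => v.
  rewrite /=; case: eqP => [->|vx].
    apply: prob_sure; first exact: measurable_hit_before_upto.
    by move=> w w0; exists 0%N; split=> //; exact: hit_at_start.
  rewrite (_ : (if _ then _ else _) = 0); last by case: ifP.
  apply: prob_never; first exact: measurable_hit_before_upto.
  by move=> w w0 [n []]; rewrite leqn0 => /eqP -> []; rewrite w0.
rewrite /=; case: eqP => [->|vx].
  apply: prob_sure; first exact: measurable_hit_before_upto.
  by move=> w w0; exists 0%N; split=> //; exact: hit_at_start.
case: eqP => [->|vy].
  apply: prob_never; first exact: measurable_hit_before_upto.
  by move=> w w0 [n [_ [_ /(_ 0%N isT)]]].
rewrite -IH -prob_shift_div; last exact: measurable_hit_before_upto.
apply: eq_prob_start.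
- exact: measurable_hit_before_upto.
- by apply: measurable_shift_preimage; exact: measurable_hit_before_upto.
- by move=> w w0; exact: (hit_before_upto_shift _ vx vy w0).
Qed.

Lemma hit_before_solution x y : x <> y ->
  hit_solution G x y (prob^~ (hit_before x y)).
Proof.
move=> xy; split.
- by apply: prob01; exact: measurable_hit_before.
- apply: prob_sure; first exact: measurable_hit_before.
  by move=> w w0; exists 0%N; exact: hit_at_start.
- apply: prob_never; first exact: measurable_hit_before.
  by move=> w; exact: hit_before_stop.
- move=> v /eqP vx /eqP vy; rewrite -prob_shift; last exact: measurable_hit_before.
  congr (_ * _); apply: eq_prob_start.
  + exact: measurable_hit_before.
  + by apply: measurable_shift_preimage; exact: measurable_hit_before.
  + by move=> w; exact: hit_before_shift.
move=> v e e0.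
have [||||k] := @prob_continuous v (hit_before_upto x y) (hit_before x y) e.
- by move=> k; exact: measurable_hit_before_upto.
- exact: measurable_hit_before.
- have -> : hit_before x y = \bigcup_k hit_before_upto x y k.
    apply/seteqP; split=> w /= [n]; first by move=> Hn; exists n => //; exists n.
    by move=> _ [m [_ Hm]]; exists m.
  apply: nondecreasing_cvg_mu.
  + by move=> k; exact: measurable_hit_before_upto.
  + by apply: bigcup_measurable => k _; exact: measurable_hit_before_upto.
  + move=> n m nm; apply/subsetPset => w [i [ni Hi]].
    by exists i; split=> //; exact: leq_trans nm.
- by [].
rewrite ler_norml => /andP[_ H]; exists k.
have -> : hit_upto G x y k v = prob v (hit_before_upto x y k).
  by rewrite -[LHS]/((hit_upto G x y k) v) -(prob_hit_before_upto k xy).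
lra.
Qed.

(** A walk that meets {x, y} does so for a first time, and this decides which of
    the two is hit before the other. *)
Lemma prob_avoid_both v x y : x <> y ->
  prob v (avoid x `&` avoid y) =
  1 - prob v (hit_before x y) - prob v (hit_before y x).
Proof.
move=> xy.
have mxy := measurable_hit_before x y; have myx := measurable_hit_before y x.
have -> : avoid x `&` avoid y = ~` (hit_before x y `|` hit_before y x).
  apply/seteqP; split=> w /=.
    by move=> [ax ay] [[n [wn _]]|[n [wn _]]]; [exact: ax wn|exact: ay wn].
  move=> /not_orP[nxy nyx].
  suff H : forall n, ~ ((w n == x) || (w n == y)).
    by split=> n /eqP wn; apply: (H n); rewrite wn ?orbT.
  move=> n0 Hn0; have ex : exists n, (w n == x) || (w n == y) by exists n0.
  case: (ex_minnP ex) => n /orP[]/eqP wn nmin.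
    apply: nxy; exists n; split=> // i ni wi.
    have := nmin i; rewrite wi eqxx orbT => /(_ isT) ni'.
    have {}ni : i = n by apply/eqP; rewrite eqn_leq ni.
    by rewrite ni wn in wi.
  apply: nyx; exists n; split=> // i ni wi.
  have := nmin i; rewrite wi eqxx => /(_ isT) ni'.
  have {}ni : i = n by apply/eqP; rewrite eqn_leq ni.
  by rewrite ni wn in wi; exact: xy.
rewrite prob_setC; last exact: measurableU.
rewrite prob_setU// ?opprD ?addrA//.
apply/seteqP; split=> w //= -[[n [wn Hn]] [m [wm Hm]]].
by have [nm|mn] := leqP n m; [exact: (Hm n nm wn)|exact: (Hn m (ltnW mn) wm)].
Qed.

Lemma prob_avoid_harmonic x v : v != x ->
  total_weight G v * prob v (avoid x) = weighted_sum G v (prob^~ (avoid x)).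
Proof.
move=> /eqP vx; rewrite -prob_shift; last exact: measurable_avoid.
congr (_ * _); apply: eq_prob_start.
- exact: measurable_avoid.
- by apply: measurable_shift_preimage; exact: measurable_avoid.
move=> w w0; split; first by move=> H n; exact: (H n.+1).
by move=> H [|n]; [rewrite w0|exact: H].
Qed.

Lemma prob_avoid_start x : prob x (avoid x) = 0.
Proof.
apply: prob_never; first exact: measurable_avoid.
by move=> w w0 /(_ 0%N).
Qed.

Lemma prob_avoid_upto0 x y v : v != x -> v != y -> prob v (avoid_upto x y 0) = 1.
Proof.
move=> /eqP vx /eqP vy; apply: prob_sure; first exact: measurable_avoid_upto.
by move=> w w0 n; rewrite leqn0 => /eqP ->; rewrite w0.
Qed.

Lemma prob_avoid_uptoS x y k v : v != x -> v != y ->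
  total_weight G v * prob v (avoid_upto x y k.+1) =
  weighted_sum G v (prob^~ (avoid_upto x y k)).
Proof.
move=> /eqP vx /eqP vy; rewrite -prob_shift; last exact: measurable_avoid_upto.
congr (_ * _); apply: eq_prob_start.
- exact: measurable_avoid_upto.
- by apply: measurable_shift_preimage; exact: measurable_avoid_upto.
move=> w w0; split; first by move=> H n nk; exact: (H n.+1).
by move=> H [|n] nk; [rewrite w0|exact: H].
Qed.

Lemma prob_avoid_upto_cvg x y v (e : R) : 0 < e ->
  exists k, prob v (avoid_upto x y k) <= prob v (avoid x `&` avoid y) + e.
Proof.
move=> e0.
have [||||k] := @prob_continuous v (avoid_upto x y) (avoid x `&` avoid y) e.
- by move=> k; exact: measurable_avoid_upto.
- by apply: measurableI; exact: measurable_avoid.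
- have -> : avoid x `&` avoid y = \bigcap_k avoid_upto x y k.
    apply/seteqP; split=> w /=.
      by move=> [wx wy] k _ n _; split; [exact: wx|exact: wy].
    by move=> H; split=> n; have [] := H n I n (leqnn n).
  apply: nonincreasing_cvg_mu.
  + apply: le_lt_trans (ltry 1); apply: probability_le1.
    exact: measurable_avoid_upto.
  + by move=> k; exact: measurable_avoid_upto.
  + by apply: bigcap_measurable => // k _; exact: measurable_avoid_upto.
  + move=> n m nm; apply/subsetPset => w H i ni.
    by apply: H; exact: leq_trans nm.
- by [].
rewrite ler_norml => /andP[H _]; exists k; lra.
Qed.

Lemma hitting_le_returnP x y (w : T) :
  (hitting_time R y w <= return_time R x w)%E <->
  forall n, (1 <= n)%N -> w n = x -> exists i, (i <= n)%N /\ w i = y.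
Proof.
split=> [H n n1 wn|H].
  have : (hitting_time R y w <= (n%:R)%:E)%E.
    by apply: le_trans H _; apply: ereal_inf_lbound; exists n.
  apply: contraPP => /forallNP nohit; apply/negP; rewrite -ltNge.
  apply: (@lt_le_trans _ _ (n.+1%:R)%:E); first by rewrite lte_fin ltr_nat.
  apply/ereal_infP => _ [i wi <-]; rewrite lee_fin ler_nat ltnNge.
  by apply/negP => ni; apply: (nohit i).
apply/ereal_infP => _ [n [n1 wn] <-].
have [i [ni wi]] := H n n1 wn.
apply: (@le_trans _ _ (i%:R)%:E); last by rewrite lee_fin ler_nat.
by apply: ereal_inf_lbound; exists i.
Qed.

Lemma return_time_finiteP x (w : T) :
  (return_time R x w < +oo)%E <-> exists n, w n.+1 = x.
Proof.
split.
  apply: contraPP => /forallNP H; apply/negP; rewrite -leNgt.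
  by apply/ereal_infP => _ [[|n] [// _ wn] <-]; have := H n wn.
move=> [n wn]; apply: (@le_lt_trans _ _ (n.+1%:R)%:E); last exact: ltry.
by apply: ereal_inf_lbound; exists n.+1.
Qed.

(** For a walk started at [x], the event fails exactly when the walk seen from
    time one on hits [x] before [y]. *)
Lemma escape_prob x y : x <> y ->
  total_weight G x *
    prob x [set w | (hitting_time R y w <= return_time R x w)%E] =
  total_weight G x - weighted_sum G x (prob^~ (hit_before x y)).
Proof.
move=> xy; rewrite -prob_shift; last exact: measurable_hit_before.
rewrite -{2}[total_weight G x]mulr1 -mulrBr.
have mS := measurable_shift_preimage (measurable_hit_before x y).
rewrite -prob_setC//; congr (_ * _); apply: eq_prob_start.
- rewrite (_ : [set _ | _] =
      [set w : T | forall n, (1 <= n)%N -> ~ hit_at x y n w]).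
    apply: (@measurable_forall V nat
      (fun n w => (1 <= n)%N -> ~ hit_at x y n w)) => // n.
    by apply: measurable_imply; apply: measurable_not; exact: measurable_hit_at.
  apply/seteqP; split=> w /=; rewrite hitting_le_returnP => H n n1.
    by move=> [wn nohit]; have [i [ni wi]] := H n n1 wn; exact: nohit wi.
  move=> wn; apply: contrapT => /forallNP nohit; apply: (H n n1).
  by split=> // i ni wi; apply: (nohit i).
- exact: measurableC.
move=> w w0 /=; rewrite hitting_le_returnP; split.
  move=> H [n [wn nohit]]; have [[|i] [ni wi]] := H n.+1 isT wn.
    by apply: xy; rewrite -w0.
  exact: (nohit i).
move=> H [//|n] _ wn; apply: contrapT => /forallNP nohit; apply: H.
by exists n; split=> // i ni wi; apply: (nohit i.+1).
Qed.

Lemma measurable_return x : measurable [set w : T | (return_time R x w < +oo)%E].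
Proof.
rewrite (_ : [set _ | _] = [set w : T | exists n, w n.+1 = x]).
  apply: (@measurable_exists V nat (fun n w => w n.+1 = x)) => // n.
  exact: measurable_at.
by apply/seteqP; split=> w /=; rewrite return_time_finiteP.
Qed.

Lemma no_return_prob x :
  total_weight G x * (1 - prob x [set w | (return_time R x w < +oo)%E]) =
  weighted_sum G x (prob^~ (avoid x)).
Proof.
rewrite -prob_shift; last exact: measurable_avoid.
rewrite -prob_setC; last exact: measurable_return.
congr (_ * prob x _); apply/seteqP; split=> w /=; rewrite return_time_finiteP.
  by move=> H n wn; apply: H; exists n.
by move=> H [n wn]; exact: H wn.
Qed.

End HittingProbabilities.

(** * Free effective resistance and recurrence *)

Section ExhaustionExists.
Set Implicit Arguments.
Unset Strict Implicit.
Context {R : realType} {V : pointedType} (G : graph R V).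
Hypotheses (Gcon : connected_graph G) (Vinf : infinite_set [set: V]).

(** Take all vertices on chosen paths from a fixed root to the first [n]
    vertices of an enumeration: each of them is linked to the root. *)
Lemma exhaustion_exists : exists W, exhaustion G W.
Proof.
have /card_esym/card_set_bijP[e [_ _ esurj]] :=
  eq_card_nat (vertices_countable G) Vinf.
have /choice[p Hp] : forall n, exists q : seq V,
    path (Defs.adjacent G) (e 0%N) q /\ last (e 0%N) q = e n.
  by move=> n; have [q [? ? _]] := @Gcon (e 0%N) (e n) I I; exists q.
pose W n : {fset V} :=
  seq_fset tt (flatten [seq e 0%N :: p i | i <- iota 0 n.+1]).
have inW n z : z \in W n <-> exists i, (i <= n)%N /\ z \in e 0%N :: p i.
  rewrite /W seq_fsetE; split.
    by move=> /flatten_mapP [i]; rewrite mem_iota => /andP[_ ni] zi; exists i.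
  by move=> [i [ni zi]]; apply/flatten_mapP; exists i; rewrite // mem_iota.
exists W; split.
- move=> n; apply/fsubsetP => z /inW[i [ni zi]]; apply/inW.
  by exists i; split=> //; exact: leqW.
- move=> v; have [n _ <-] := esurj v I; exists n; apply/inW; exists n.
  by split=> //; have [_ <-] := Hp n; exact: mem_last.
- move=> n.
  pose linked a b := exists q, [/\ path (Defs.adjacent G) a q, last a q = b
                                 & forall z, z \in q -> z \in W n].
  have link_trans a b c : linked a b -> linked b c -> linked a c.
    move=> [q [aq qb qW]] [r [br rc rW]]; exists (q ++ r); split.
    + by rewrite cat_path aq qb.
    + by rewrite last_cat qb.
    + by move=> z; rewrite mem_cat => /orP[/qW|/rW].
  have link_sym a b : a \in W n -> linked a b -> linked b a.
    move=> aW [q [aq <- qW]]; elim: q a aW aq qW => [|u q IH] a aW /=.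
      by move=> _ _; exists [::].
    move=> /andP[au uq] qW; apply: (link_trans _ u).
      by apply: IH => // [|z zq]; apply: qW; rewrite inE ?eqxx ?zq ?orbT.
    exists [:: a]; split=> //=; last by move=> z; rewrite inE => /eqP ->.
    by rewrite andbT /Defs.adjacent weight_sym.
  have root z : z \in W n -> linked (e 0%N) z.
    move=> /inW[i [ni zi]]; have pW : forall u, u \in p i -> u \in W n.
      by move=> u ui; apply/inW; exists i; split=> //; rewrite inE ui orbT.
    have [pth _] := Hp i; move: pth pW; case/splitPl: zi => q r qz.
    rewrite cat_path => /andP[pq _] pW; exists q; split=> // u uq.
    by apply: pW; rewrite mem_cat uq.
  have eW : e 0%N \in W n by apply/inW; exists 0%N; rewrite inE eqxx.
  move=> a b aW bW; apply: (link_trans _ (e 0%N)); last exact: root.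
  by apply: link_sym => //; exact: root.
Qed.

Lemma solves_exist W x y : exhaustion G W -> x != y ->
  exists u, solves_on_exhaustion G W x y u.
Proof.
move=> Wexh xy; have [_ _ Wcon] := Wexh.
have /choice[u Hu] : forall n, exists f : V -> R,
    x \in W n -> y \in W n -> dirichlet G (W n) x y f.
  move=> n; case: (boolP ((x \in W n) && (y \in W n))) => [/andP[xW yW]|nW].
    by have [f Hf] := dirichlet_exists (Wcon n) xW yW xy; exists f.
  by exists (fun=> 0) => xW yW; rewrite xW yW in nW.
exists u; near=> n.
have H : {subset [fset x; y]%fset <= W n} by near: n; exact: exhaustion_near Wexh.
have xW : x \in W n by apply: H; rewrite !inE eqxx.
have yW : y \in W n by apply: H; rewrite !inE eqxx orbT.
by split; rewrite //; exact: Hu.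
Unshelve. all: by end_near. Qed.

Lemma eff_res_near W x y u : exhaustion G W -> x != y ->
  solves_on_exhaustion G W x y u ->
  \forall n \near \oo, eff_res G (W n) x y = (laplacian G (W n) (u n) x)^-1.
Proof.
move=> Wexh xy usol; apply: filterS usol => n [Wc xW yW dir].
exact: eff_resE.
Qed.

Lemma free_eff_res_unique x y (r : R) :
  (forall W, exhaustion G W -> eff_res G (W n) x y @[n --> \oo] --> r) ->
  free_eff_res G x y = r.
Proof.
move=> H; apply: xget_unique => // r' Hr'.
have [W Wexh] := exhaustion_exists.
by apply: (@cvg_unique _ (@norm_hausdorff _ R) (eff_res G (W n) x y @[n --> \oo]));
  [exact: Hr' | exact: H].
Qed.

(** The default value of [free_eff_res] is zero, so a nonzero value is a
    genuine limit. *)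
Lemma free_eff_res_cvg x y W : free_eff_res G x y != 0 -> exhaustion G W ->
  eff_res G (W n) x y @[n --> \oo] --> free_eff_res G x y.
Proof.
move=> nz Wexh.
pose limits := [set r : R | forall W, exhaustion G W ->
  eff_res G (W n) x y @[n --> \oo] --> r].
have [ex|no] := pselect (exists r, limits r).
  by have := xgetPex 0 ex => /(_ W Wexh).
move: nz; rewrite /free_eff_res xgetPN ?eqxx// => r Hr.
by apply: no; exists r.
Qed.

End ExhaustionExists.

Section Equivalence.
Set Implicit Arguments.
Unset Strict Implicit.
Context {R : realType} {V : pointedType} (G : graph R V).
Variable P : V -> probability (trajectory V) R.
Hypothesis hP : forall x, is_walk_law G x (P x).
Hypotheses (Gcon : connected_graph G) (Vinf : infinite_set [set: V]).
Local Notation T := (trajectory V).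

Local Notation h x y := (prob P ^~ (hit_before x y)).
Local Notation both x y := (prob P ^~ (avoid x `&` avoid y)).

(** Equal to c_x P_x(T_y <= T_x^+) by [escape_prob]. *)
Definition escape x y : R := total_weight G x - weighted_sum G x (h x y).

Let hsol x y (xy : x <> y) : hit_solution G x y (h x y) :=
  hit_before_solution hP Gcon Vinf xy.

(** Otherwise [h x y] would equal 1 at all neighbours of [x], and then, by
    harmonicity and connectedness, also at [y]. *)
Lemma escape_gt0 x y : x <> y -> 0 < escape x y.
Proof.
move=> xy; have H := hsol xy; have h01 := hit_unit H.
have hC01 := unit_valuedC h01.
rewrite /escape -weighted_sumC// ltNge; apply/negP => s0.
have : forall v, h x y v = 1.
  apply: (connected_ind (Z := [set v | h x y v = 1]) Gcon (hit_start H)).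
  move=> v w /= hv vw.
  have vy : v != y.
    apply/eqP => vy; move: hv; rewrite vy (hit_stop H) => /esym/eqP.
    by rewrite oner_eq0.
  suff : 1 - h x y w = 0 by lra.
  apply: (weighted_sum_eq0 hC01 _ vw).
  have [->//|vx] := eqVneq v x.
  by rewrite weighted_sumC// -(hit_harmonic H)// hv mulr1 subrr.
move=> /(_ y); rewrite (hit_stop H) => /esym/eqP; by rewrite oner_eq0.
Qed.

Lemma both01 x y : unit_valued (both x y).
Proof. by apply: prob01; apply: measurableI; exact: measurable_avoid. Qed.

Lemma weighted_sum_both v x y : x <> y ->
  weighted_sum G v (both x y) =
  total_weight G v - weighted_sum G v (h x y) - weighted_sum G v (h y x).
Proof.
move=> xy.
have hxy := hit_unit (hsol xy).
have hyx : unit_valued (h y x) by apply: prob01; exact: measurable_hit_before.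
rewrite -(weighted_sumC G v hxy); apply/eqP; rewrite eq_sym subr_eq; apply/eqP.
rewrite -weighted_sumD//; last exact: both01.
by apply: eq_weighted_sum => w; rewrite prob_avoid_both// subrK.
Qed.

(** When the walk cannot avoid both [x] and [y], the lower and upper bounds for
    the currents coincide. *)
Lemma free_eff_res_of_both0 x y : x <> y ->
  (forall v, both x y v = 0) -> free_eff_res G x y = 1 / escape x y.
Proof.
move=> xy b0; have yx : y <> x by move=> /esym.
have xy' : x != y by apply/eqP.
have A0 := escape_gt0 xy.
have Eyx : weighted_sum G x (h y x) = escape x y.
  have := weighted_sum_both x xy; rewrite (weighted_sum_fun0 G x b0).
  rewrite /escape; lra.
apply: free_eff_res_unique => // W Wexh.
have [u usol] := solves_exist Wexh xy'.
have Lcvg : laplacian G (W n) (u n) x @[n --> \oo] --> escape x y.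
  apply/cvgrPdist_le => e e0; near=> n; rewrite distrC ler_distl; apply/andP; split.
    by rewrite -Eyx; near: n; exact: (le_current Gcon Vinf Wexh usol (hsol yx) e0).
  by near: n; exact: (current_le Gcon Vinf Wexh usol (hsol xy) e0).
rewrite div1r.
apply: cvg_trans (cvgV _ Lcvg); last by rewrite gt_eqF.
apply: near_eq_cvg; apply: filterS (eff_res_near Wexh xy' usol) => n ->.
by [].
Unshelve. all: by end_near. Qed.

Lemma escape_le_hit x y : x <> y -> free_eff_res G x y = 1 / escape x y ->
  escape x y <= weighted_sum G y (h x y).
Proof.
move=> xy E; have xy' : x != y by apply/eqP.
have A0 := escape_gt0 xy.
have [W Wexh] := exhaustion_exists Gcon Vinf.
have [u usol] := solves_exist Wexh xy'.
apply: (escape_le Gcon Vinf Wexh xy' usol (hsol xy)) => e e0.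
have nz : free_eff_res G x y != 0 by rewrite E div1r invr_eq0 gt_eqF.
have Rcvg := free_eff_res_cvg nz Wexh.
have : (eff_res G (W n) x y)^-1 @[n --> \oo] --> (free_eff_res G x y)^-1.
  exact: cvgV.
move=> /cvgrPdist_le/(_ e e0); rewrite E div1r invrK => H.
near=> n.
have : `|escape x y - (eff_res G (W n) x y)^-1| <= e by near: n; exact: H.
have -> : eff_res G (W n) x y = (laplacian G (W n) (u n) x)^-1.
  by near: n; exact: eff_res_near.
rewrite invrK ler_norml -/(escape x y) => /andP[_]; lra.
Unshelve. all: by end_near. Qed.

(** The inequalities of [escape_le_hit] for (x, y) and for (y, x) leave no room
    for a positive weighted sum of [both x y] at [x] or at [y]. *)
Lemma both_eq0 x y : x <> y ->
  free_eff_res G x y = 1 / escape x y -> free_eff_res G y x = 1 / escape y x ->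
  forall v, both x y v = 0.
Proof.
move=> xy Exy Eyx; have yx : y <> x by move=> /esym.
have := escape_le_hit xy Exy; have := escape_le_hit yx Eyx.
have bx := weighted_sum_both x xy; have byy := weighted_sum_both y xy.
have := weighted_sum_ge0 G x (both01 x y).
have := weighted_sum_ge0 G y (both01 x y).
rewrite /escape => by0 bx0 ine1 ine2.
have bx00 : weighted_sum G x (both x y) <= 0 by lra.
have by00 : weighted_sum G y (both x y) <= 0 by lra.
apply: (connected_ind (Z := [set v | both x y v = 0]) Gcon (x := x)).
  by rewrite /= prob_avoid_both// (hit_start (hsol xy)) (hit_stop (hsol yx)); ring.
move=> v w /= bv vw; apply: (weighted_sum_eq0 (both01 x y) _ vw).
have [->//|vx] := eqVneq v x; have [->//|vy] := eqVneq v y.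
rewrite weighted_sum_both// -(hit_harmonic (hsol xy))// -(hit_harmonic (hsol yx))//.
have := bv; rewrite prob_avoid_both// => hv.
have -> : total_weight G v - total_weight G v * h x y v -
  total_weight G v * h y x v = total_weight G v * (1 - h x y v - h y x v) by ring.
by rewrite hv mulr0.
Qed.

(** A walk that avoids [x] either has not met [y] by time [k], or it continues
    from [y] avoiding [x]. The comparison is by induction on [k], both sides
    obeying the same recursion off {x, y}. *)
Lemma avoid_le x y k v :
  prob P v (avoid x) <= prob P y (avoid x) + prob P v (avoid_upto x y k).
Proof.
have g01 := prob01 P (measurable_avoid x).
have b01 j := prob01 P (measurable_avoid_upto x y j).
elim: k v => [|k IH] v; have /andP[gy0 _] := g01 y.
  have /andP[bv0 _] := b01 0%N v.
  have [->|vx] := eqVneq v x.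
    rewrite (prob_avoid_start hP); have /andP[? _] := b01 0%N x; exact: addr_ge0.
  have [->|vy] := eqVneq v y; first by rewrite lerDl; have /andP[] := b01 0%N y.
  rewrite (prob_avoid_upto0 hP)//; have /andP[_ gv1] := g01 v.
  by apply: le_trans gv1 _; rewrite lerDr.
have [->|vx] := eqVneq v x.
  by rewrite (prob_avoid_start hP); have /andP[? _] := b01 k.+1 x; exact: addr_ge0.
have [->|vy] := eqVneq v y; first by rewrite lerDl; have /andP[] := b01 k.+1 y.
have c0 := total_weight_gt0 v Gcon Vinf.
rewrite -(ler_pM2l c0) (prob_avoid_harmonic hP Gcon Vinf)// mulrDr.
rewrite (prob_avoid_uptoS hP Gcon Vinf)//.
apply: weighted_sum_le => // F.
apply: (@le_trans _ _ (\sum_(w <- F) (G v w * prob P y (avoid x) +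
                          G v w * prob P w (avoid_upto x y k)))).
  by apply: ler_sum => w _; rewrite -mulrDr ler_wpM2l ?weight_ge0.
rewrite big_split /= -mulr_suml lerD//; last exact: (le_weighted_sum_fset G v F (b01 k)).
by rewrite ler_wpM2r// le_total_weight_fset.
Qed.

(** Letting [k] tend to infinity in [avoid_le], the probability of avoiding [x]
    is maximal from [y]. Being harmonic off [x], it would be constant if this
    maximum were positive, but it is zero from [x]. *)
Lemma avoid_eq0 x y : x <> y -> (forall v, both x y v = 0) ->
  forall v, prob P v (avoid x) = 0.
Proof.
move=> xy b0.
have g01 := prob01 P (measurable_avoid x).
set beta := prob P y (avoid x).
have /andP[beta0 beta1] : 0 <= beta <= 1 := g01 y.
have gle v : prob P v (avoid x) <= beta.
  apply/ler_addgt0Pr => e e0.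
  have [k Hk] := prob_avoid_upto_cvg P x y v e0.
  apply: le_trans (avoid_le x y k v) _.
  by rewrite lerD2l; apply: le_trans Hk _; rewrite b0 add0r.
suff beta00 : beta = 0.
  move=> v; apply/eqP; rewrite eq_le -{1}beta00 gle.
  by have /andP[] := g01 v.
apply: contrapT => betaN0.
pose f v := beta - prob P v (avoid x).
have f01 : unit_valued f.
  move=> v; have /andP[g0 g1] := g01 v; have := gle v; rewrite /f; lra.
have : forall v, f v = 0.
  apply: (connected_ind (Z := [set v | f v = 0]) Gcon (x := y)).
    by rewrite /= /f subrr.
  move=> v w /= fv vw; apply: (weighted_sum_eq0 f01 _ vw).
  have vx : v != x.
    apply/eqP => vx; apply: betaN0; move: fv.
    by rewrite /f vx (prob_avoid_start hP) subr0.
  have : weighted_sum G v f + weighted_sum G v (prob P ^~ (avoid x)) <=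
         total_weight G v * beta.
    rewrite -weighted_sumD//; apply: weighted_sum_le.
      by move=> z; rewrite /f subrK beta0.
    move=> F; under eq_bigr do rewrite /f subrK.
    by rewrite -mulr_suml ler_wpM2r// le_total_weight_fset.
  rewrite -(prob_avoid_harmonic hP Gcon Vinf)//.
  have -> : prob P v (avoid x) = beta by move: fv; rewrite /f; lra.
  lra.
move=> /(_ x); rewrite /f (prob_avoid_start hP) subr0; exact: betaN0.
Qed.

(** Recurrence of [x] says that the probability of avoiding [x] is harmonic at
    [x] too. A nonnegative harmonic function with a zero vanishes. *)
Lemma recurrentE : recurrent P <-> forall x v, prob P v (avoid x) = 0.
Proof.
split=> [rec x|av x].
  have g01 := prob01 P (measurable_avoid x).
  apply: (connected_ind (Z := [set v | prob P v (avoid x) = 0]) Gcon (x := x)).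
    exact: prob_avoid_start hP x.
  move=> v w /= gv vw; apply: (weighted_sum_eq0 g01 _ vw).
  have [->|vx] := eqVneq v x.
    by rewrite -(no_return_prob hP Gcon Vinf) /prob rec subrr mulr0.
  by rewrite -(prob_avoid_harmonic hP Gcon Vinf)// gv mulr0.
rewrite -(probE P x (measurable_return x)); congr (_%:E).
have := no_return_prob hP Gcon Vinf x.
rewrite (weighted_sum_fun0 G x (av x)).
move=> /eqP; rewrite mulf_eq0 gt_eqF ?total_weight_gt0//= subr_eq0 => /eqP.
by move=> <-.
Qed.

End Equivalence.

Theorem corollary6p5 (R : realType) (V : pointedType) (G : graph R V)
    (P : V -> probability (trajectory V) R)
    (hP : forall x, is_walk_law G x (P x))
    (Vinfinite : infinite_set [set: V])
    (Gconnected : connected_graph G) :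
  (forall x y : V, x <> y ->
     free_eff_res G x y =
     1 / (total_weight G x *
          fine (P x [set w | (hitting_time R y w <= return_time R x w)%E])))
  <-> recurrent P.
Proof.
have escapeE x y : x <> y -> total_weight G x *
    fine (P x [set w | (hitting_time R y w <= return_time R x w)%E]) =
    escape G P x y.
  exact: escape_prob.
rewrite (recurrentE hP)//; split=> [formula x|av x y xy].
  have [y yx] : exists y, y <> x.
    apply: contrapT => /forallNP H; apply: Vinfinite.
    rewrite (_ : [set: V] = [set x]); first exact: finite_set1.
    by apply/seteqP; split=> // y _; apply: contrapT; exact: H.
  have xy : x <> y by move=> /esym.
  apply: (avoid_eq0 hP Gconnected Vinfinite xy).
  by apply: (both_eq0 hP Gconnected Vinfinite xy); rewrite formula// escapeE.
rewrite escapeE//; apply: (free_eff_res_of_both0 hP) => // v.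
have mx := measurable_avoid x; have my := measurable_avoid y.
apply/eqP; rewrite eq_le; have /andP[-> _] := both01 P x y v.
by rewrite andbT -(av x v); apply: prob_mono => //; exact: measurableI.
Qed.
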